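(* Let $F$ be a field of characteristic zero and $A$ a superalgebra over $F$ with a superinvolution or graded involution $\#$, with $\langle n\rangle$-th $\#$-cocharacters $\chi_{\langle n\rangle}(A)=\sum_{\langle\lambda\rangle\vdash\langle n\rangle}m_{\langle\lambda\rangle}\chi_{\langle\lambda\rangle}$. Suppose $A$ is a PI-algebra and let $\langle d,l\rangle=(d_1,l_1;d_2,l_2;d_3,l_3;d_4,l_4)$ with $d_i,l_i\ge0$. Then $A$ satisfies the Amitsur $\#$-superidentity $E_{\langle d,l\rangle}$ of rank $\langle d,l\rangle$ if and only if $m_{\langle\lambda\rangle}=0$ for every $\langle n\rangle$ and every $\langle\lambda\rangle\vdash\langle n\rangle$ with $\langle\lambda\rangle\notin\mathcal H_{\langle d,l\rangle}$.
   Context: A superalgebra is $A=A_0\oplus A_1$; a superinvolution is an $F$-linear $\#$ with $A_i^\#\subseteq A_i$, $(c^\#)^\#=c$, $(ab)^\#=(-1)^{\deg a\deg b}b^\#a^\#$; a graded involution is $F$-linear $\#$ with $A_i^\#\subseteq A_i$, $(c^\#)^\#=c$, $(ab)^\#=b^\#a^\#$. $A_i^\pm=\{a\in A_i:a^\#=\pm a\}$. PI-algebra: satisfies a nontrivial ordinary polynomial identity. $\mathcal F$ is the free non-unital associative algebra on $y_{i,j}$ (symmetric), $z_{i,j}$ (skew), $i\in\{0,1\}$, $j\ge1$, graded by the first index, with induced $\#$. $f\equiv0$ in $A$ ($\#$-superidentity) means $f$ vanishes under all substitutions $y_{0,j}\mapsto A_0^+$, $z_{0,j}\mapsto A_0^-$,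 $y_{1,j}\mapsto A_1^+$, $z_{1,j}\mapsto A_1^-$; $Id_2^\#(A)$ is their set. For $\langle n\rangle=(n_1,\dots,n_4)$, $P_{\langle n\rangle}$ is the span of monomials multilinear in $y_{0,1..n_1},z_{0,1..n_2},y_{1,1..n_3},z_{1,1..n_4}$, with $S_{n_1}\times\cdots\times S_{n_4}$ permuting second indices of each type; $\chi_{\langle n\rangle}(A)$ is the character of $P_{\langle n\rangle}/(P_{\langle n\rangle}\cap Id_2^\#(A))$, decomposed over $\chi_{\langle\lambda\rangle}=\chi_{\lambda(1)}\otimes\cdots\otimes\chi_{\lambda(4)}$, $\lambda(i)\vdash n_i$. $\mathcal H(d,l)$ is the set of partitions with $\lambda_{d+1}\le l$, and $\langle\lambda\rangle\in\mathcal H_{\langle d,l\rangle}$ means $\lambda(i)\in\mathcal H(d_i,l_i)$ for all $i$. Amitsur polynomials: for $i=1,\dots,4$ let $k_i=(l_i+1)(d_i+1)$, let $\hat\lambda(i)\vdash k_i$ be the rectangular partition with $d_i+1$ parts all equal to $l_i+1$, and $\widehat k=\max_i k_i$. Define $E_{1}=\sum_{\sigma\in S_{k_1}}\chi_{\hat\lambda(1)}(\sigma)x_1y_{0,\sigma(1)}x_2\cdots x_{k_1}y_{0,\sigma(k_1)}x_{k_1+1}$, and $E_2,E_3,E_4$ likewise with special variables $z_{0,1},\dots,z_{0,k_2}$ (character $\chi_{\hat\lambda(2)}$, $k_2$), $y_{1,1},\dots,y_{1,k_3}$ (character $\chi_{\hat\lambda(3)}$, $k_3$), $z_{1,1},\dots,z_{1,k_4}$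 (character $\chi_{\hat\lambda(4)}$, $k_4$) in place of $y_{0,\cdot}$, where each $x_j$ ($j=1,\dots,\widehat k+1$) is any element of $\{y_{0,k_1+j},z_{0,k_2+j},y_{1,k_3+j},z_{1,k_4+j},1\}$ (choosing $x_j=1$ means $x_j$ is omitted). $A$ satisfies $E_{\langle d,l\rangle}$ if $E_i\equiv0$ in $A$ for $i=1,2,3,4$ and for all such choices of the $x_j$. *)

(* Defs.v *)
From HB Require Import structures.
From mathcomp Require Import all_boot all_order all_fingroup all_algebra.
From mathcomp Require Import mpoly.
From Stdlib Require Import ClassicalEpsilon.
Set Implicit Arguments. Unset Strict Implicit. Unset Printing Implicit Defensive.
Import GRing.Theory.
Local Open Scope ring_scope.

Definition is_partition (m : nat) (lam : seq nat) : bool :=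
  [&& sorted geq lam, all (fun x => 0 < x)%N lam & sumn lam == m].

(* lam \in H(d,l) iff lam_{d+1} <= l  (lam_{d+1} = nth 0 lam d, 0-indexed) *)
Definition in_hook (d l : nat) (lam : seq nat) : bool := (nth 0 lam d <= l)%N.

(* Irreducible characters of S_m indexed by partitions:                *)
(* Frobenius character formula                                         *)
(*   chi_lam(sigma) = [x^(lam+delta)] ( prod_{i<j} (x_i - x_j) *       *)
(*                       prod_{cycles c of sigma} p_{|c|}(x) )         *)
(* in m variables, with delta = (m-1, ..., 1, 0).                      *)

Definition power_sum (N r : nat) : {mpoly int[N]} := \sum_(i < N) 'X_i ^+ r.

Definition vandermonde (N : nat) : {mpoly int[N]} :=
  \prod_(i < N) \prod_(j < N | (i < j)%N) ('X_i - 'X_j).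

Definition frob_exp (N : nat) (lam : seq nat) : 'X_{1..N} :=
  [multinom (nth 0 lam i + (N - 1 - i))%N | i < N].

Definition Schar (m : nat) (lam : seq nat) (s : {perm 'I_m}) : int :=
  (vandermonde m * \prod_(c in porbits s) power_sum m #|c|)@_(frob_exp m lam).

(* A is modelled as an F-vector space V with a bilinear associative    *)
(* (not necessarily unital) product mul; A0, A1 are the homogeneous    *)
(* components; inv is #.  super = true : superinvolution,              *)
(* super = false : graded involution.                                  *)

Section Superalg.
Variable F : fieldType.
Variable V : lmodType F.

Definition subspaceP (S : V -> Prop) : Prop :=
  S 0 /\ forall (a : F) (x y : V), S x -> S y -> S (a *: x + y).

Definition Agr (A0 A1 : V -> Prop) (b : bool) : V -> Prop := if b then A1 else A0.

Definition superalg_with_inv (mul : V -> V -> V) (A0 A1 : V -> Prop)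
    (inv : V -> V) (super : bool) : Prop :=
  [/\ [/\ (forall (a : F) x y z, mul (a *: x + y) z = a *: mul x z + mul y z),
      (forall (a : F) x y z, mul z (a *: x + y) = a *: mul z x + mul z y) &
      (forall x y z, mul x (mul y z) = mul (mul x y) z)],
      subspaceP A0 /\ subspaceP A1,
      (forall v, exists a0 a1, [/\ A0 a0, A1 a1 & v = a0 + a1]) /\
      (forall v, A0 v -> A1 v -> v = 0),
      (forall (b c : bool) x y, Agr A0 A1 b x -> Agr A0 A1 c y ->
          Agr A0 A1 (b (+) c) (mul x y)) &
      [/\ (forall (a : F) x y, inv (a *: x + y) = a *: inv x + inv y),
          (forall (b : bool) x, Agr A0 A1 b x -> Agr A0 A1 b (inv x)),
          (forall x, inv (inv x) = x) &
          (if super then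
             forall (b c : bool) x y, Agr A0 A1 b x -> Agr A0 A1 c y ->
               inv (mul x y) = (- 1) ^+ (b && c) *: mul (inv y) (inv x)
           else forall x y, inv (mul x y) = mul (inv y) (inv x))]].

(* product of a word (empty word evaluates to 0; never used on empty words) *)
Definition evalw (mul : V -> V -> V) (w : seq V) : V :=
  if w is x :: r then foldl mul x r else 0.

(* PI-algebra: a nonzero element of the free non-unital algebra
   F<x_0, x_1, ...> (finite combination of distinct nonempty words with some
   nonzero coefficient) vanishing under all substitutions. *)
Definition PI_algebra (mul : V -> V -> V) : Prop :=
  exists (ws : seq (seq nat)) (c : seq nat -> F),
    [/\ uniq ws, all (fun w => w != [::]) ws, has (fun w => c w != 0) ws &
        forall s : nat -> V, \sum_(w <- ws) c w *: evalw mul (map s w) = 0].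

(* The four kinds of variables, t : 'I_4:
   0 ~ y_0 (A0^+), 1 ~ z_0 (A0^-), 2 ~ y_1 (A1^+), 3 ~ z_1 (A1^-). *)
Definition Aset (A0 A1 : V -> Prop) (inv : V -> V) (t : 'I_4) (v : V) : Prop :=
  Agr A0 A1 (2 <= t)%N v /\ inv v = (if odd t then - v else v).

End Superalg.

(* the variables of P_<n>: (t, j) is the (j+1)-th variable of kind t *)
Definition Xvar (n : 'I_4 -> nat) : finType := {t : 'I_4 & 'I_(n t)}.

(* multilinear monomials: orderings of all variables; the permutation pi
   encodes the monomial  pi(x_1) pi(x_2) ... pi(x_N)  where x_1..x_N is the
   fixed enumeration of Xvar n. *)
Definition Mon (n : 'I_4 -> nat) : finType := {perm Xvar n}.

Definition Pdim (n : 'I_4 -> nat) : nat := #|{: Mon n}|.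

Definition monw (n : 'I_4 -> nat) (pi : Mon n) : seq (Xvar n) :=
  [seq pi x | x <- enum (Xvar n)].

Definition monOf (n : 'I_4 -> nat) (a : 'I_(Pdim n)) : Mon n := enum_val a.

Definition Grp (n : 'I_4 -> nat) : finType := {dffun forall t : 'I_4, {perm 'I_(n t)}}.

Definition Ginv (n : 'I_4 -> nat) (g : Grp n) : Grp n :=
  [ffun t => (g t)^-1%g].

Definition gact (n : 'I_4 -> nat) (g : Grp n) (x : Xvar n) : Xvar n :=
  Tagged (fun t => 'I_(n t)) (g (tag x) (tagged x)).

Section Cochar.
Variables (F : fieldType) (V : lmodType F) (mul : V -> V -> V)
  (A0 A1 : V -> Prop) (inv : V -> V) (n : 'I_4 -> nat).

(* elements of P_<n>: row vectors of coefficients on multilinear monomials *)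
Definition is_sid (f : 'rV[F]_(Pdim n)) : Prop :=
  forall s : Xvar n -> V, (forall x, Aset A0 A1 inv (tag x) (s x)) ->
    \sum_(a < Pdim n) f 0 a *: evalw mul (map s (monw (monOf a))) = 0.

Definition IdP : 'M[F]_(Pdim n) :=
  epsilon (inhabits 0)
    (fun U : 'M[F]_(Pdim n) => forall f : 'rV_(Pdim n), (f <= U)%MS <-> is_sid f).

Definition gmat (g : Grp n) : 'M[F]_(Pdim n) :=
  \matrix_(a, b) ([forall x, monOf b x == gact g (monOf a x)] : bool)%:R.

(* trace of g on the invariant subspace IdP, and on P_<n>/(P_<n> \cap Id) *)
Definition trace_on (U M : 'M[F]_(Pdim n)) : F :=
  \tr (row_base U *m M *m pinvmx (row_base U)).

Definition cochar (g : Grp n) : F := \tr (gmat g) - trace_on IdP (gmat g).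

Definition chi4 (lam : 'I_4 -> seq nat) (g : Grp n) : F :=
  \prod_(t < 4) (Schar (lam t) (g t))%:~R.

(* multiplicity m_<lam> of chi_<lam> in chi_<n>(A), computed in F by
   the orthogonality relations *)
Definition mult (lam : 'I_4 -> seq nat) : F :=
  (#|{: Grp n}|%:R)^-1 * \sum_(g : Grp n) cochar g * chi4 lam (Ginv g).

End Cochar.

Definition kk (d l : 'I_4 -> nat) (i : 'I_4) : nat := ((l i).+1 * (d i).+1)%N.

Definition rect (d l : nat) : seq nat := nseq d.+1 l.+1.

Section Amitsur.
Variables (F : fieldType) (V : lmodType F) (mul : V -> V -> V)
  (A0 A1 : V -> Prop) (inv : V -> V).

(* the word x_1 y_{s(1)} x_2 ... x_k y_{s(k)} x_{k+1}, where the optional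
   x_j is omitted when it is None (the choice x_j = 1) *)
Definition amitsur_word (k : nat) (a : 'I_k -> V) (b : 'I_k.+1 -> option V)
    (s : {perm 'I_k}) : seq V :=
  flatten [seq oapp (fun v => [:: v]) [::] (b (widen_ord (leqnSn k) j))
                 ++ [:: a (s j)] | j <- enum 'I_k] ++ oapp (fun v => [:: v]) [::] (b ord_max).

(* E_i = 0 in A for every choice of the x_j: all variables occurring are
   distinct, so a substitution is an independent choice of the special
   values a_j in the set of kind i and of the values b_j of the x_j in the
   set of their kind c_j (c_j = None means x_j = 1). *)
Definition satisfies_E (d l : 'I_4 -> nat) : Prop :=
  forall (i : 'I_4) (c : 'I_(kk d l i).+1 -> option 'I_4)
         (a : 'I_(kk d l i) -> V) (b : 'I_(kk d l i).+1 -> V),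
    (forall j, Aset A0 A1 inv i (a j)) ->
    (forall j t, c j = Some t -> Aset A0 A1 inv t (b j)) ->
    \sum_(s : {perm 'I_(kk d l i)})
       (Schar (rect (d i) (l i)) s)%:~R *:
         evalw mul (amitsur_word a (fun j => omap (fun _ => b j) (c j)) s) = 0.

End Amitsur.

(* Main.v *)
From Pilot Require Import Defs.
From HB Require Import structures.
From mathcomp Require Import all_boot all_order all_fingroup all_algebra.
From mathcomp Require Import algC classfun character vcharacter.
From mathcomp Require Import mpoly zify ring.
From Stdlib Require Import Classical ClassicalEpsilon.
Set Implicit Arguments. Unset Strict Implicit. Unset Printing Implicit Defensive.
Import GRing.Theory Num.Theory.
Local Open Scope ring_scope.

(** The Frobenius coefficient [chi_lam] is an alternating sum of permutation
    characters on cosets of Young subgroups (colorings with prescribed content).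
    Pieri's rule makes [<chi_lam, M_beta>] vanish unless [lam] dominates [beta],
    whence the [chi_lam] are orthonormal; being virtual characters of norm one
    they are irreducible up to sign, and they span.  Extracting a coefficient of
    a product with the first power sum gives the branching rule.  Hence, for
    [mu] a partition of [k], the element [z_mu] of [F[S_k]], seen in [F[S_n]],
    generates a two-sided ideal containing [z_lam] exactly when [mu] is contained
    in [lam], and is killed by [z_lam] otherwise.  Take [mu] to be the
    [(d+1) x (l+1)] rectangle, so that [mu] is contained in [lam] iff [lam] lies
    outside the hook.  The multiplicity of [lam] is zero iff [z_lam] maps P_<n>
    into the identities (the trace of an idempotent is its rank), and [z_mu]
    applied to a monomial is, after collapsing the blocks between the special
    variables into single letters and using multilinearity, an Amitsur
    polynomial. *)

(** * Colorings and permutation characters *)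

(** [F] is an arbitrary field of characteristic zero and the multiplicity is an element of [F], so
    no irreducible module over [F] is available to start with. All facts on symmetric groups are
    therefore stated as identities between integer values of [Schar]. They are proved by counting
    colorings or with complex characters, and are then carried to [F], where characteristic zero
    keeps nonzero integers nonzero. Irreducibility up to sign is enough, since the convolution
    identities have the same degree in [Schar] on both sides. The element z_mu is not central in
    F[S_n], and the two implications meet this obstacle differently. To generate z_lam, the
    conjugates of z_mu are summed: the sum is central and acts on the component of [lam] by a scalar
    in which the branching number appears. To show that z_lam kills z_mu itself, averaging would be
    too weak: there the coefficients of the product are integers whose sum of squares is a multiple
    of the branching number. *)

Section Colorings.
Variables (n : nat) (C : finType).
Implicit Types (f : {ffun 'I_n -> C}) (g h : {perm 'I_n}).

Definition colfix f g : bool := [forall x, f (g x) == f x].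

Definition col_count f (c : C) : nat := #|[pred x | f x == c]|.

Lemma colfixP f g : reflect (forall x, f (g x) = f x) (colfix f g).
Proof. by apply: (iffP forallP) => h x; apply/eqP. Qed.

Lemma col_count_count f c : col_count f c = count_mem c (codom f).
Proof.
rewrite /col_count codomE count_map cardE size_filter -enumT.
by apply: eq_count => x.
Qed.

Lemma sum_col_count f : (\sum_c col_count f c)%N = n.
Proof.
rewrite -[RHS]card_ord -sum1_card (partition_big f predT) //=.
by apply: eq_bigr => c _; rewrite sum1_card.
Qed.

Lemma col_count_perm f g : col_count [ffun x => f (g x)] =1 col_count f.
Proof.
move=> c; rewrite /col_count -(card_imset _ (@perm_inj _ g)).
apply: eq_card => x; apply/imsetP/idP => [[y]|fx].
  by rewrite !inE ffunE => fy ->.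
by exists (g^-1 x)%g; rewrite ?permKV // !inE ffunE permKV.
Qed.

Lemma col_count_transitive f f' :
  col_count f =1 col_count f' -> exists h, f' = [ffun x => f (h x)].
Proof.
move=> ff'.
have: perm_eq (codom f') (codom f).
  by apply/allP => c _ /=; rewrite -!col_count_count ff'.
have szc (k : {ffun 'I_n -> C}) : size (codom k) == n.
  by rewrite size_codom card_ord.
case/(tuple_permP (t := Tuple (szc f))) => h eq_ff'.
exists h; apply/ffunP => x; rewrite ffunE.
have nthc (k : {ffun 'I_n -> C}) (y : 'I_n) : nth (f x) (codom k) y = k y.
  by rewrite codomE (nth_map y) ?size_enum_ord // nth_ord_enum.
rewrite -[LHS]nthc eq_ff' (nth_map x) ?size_enum_ord // nth_ord_enum.
by rewrite (tnth_nth (f x)) /= nthc.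
Qed.

Lemma exists_coloring (A : C -> nat) :
  (\sum_c A c)%N = n -> exists f, col_count f =1 A.
Proof.
move=> sA; pose s := flatten [seq nseq (A c) c | c <- enum C].
have szs : size s = n.
  rewrite size_flatten /shape -map_comp sumnE big_map big_enum /= -sA.
  by apply: eq_bigr => c _; rewrite size_nseq.
(* [nth] needs a default colour, and [C] may be empty when [n] is 0; there the empty function
   serves. *)
have [n0|n_gt0] := posnP n.
  have A0 c : A c = 0%N.
    apply/eqP; move/eqP: sA; rewrite n0 sum_nat_eq0 => /forallP /(_ c).
    exact.
  have f0 : #|'I_n| = 0%N by rewrite card_ord.
  exists (ffun0 f0) => c; rewrite A0 /col_count; apply: eq_card0 => -[x lx].
  by exfalso; rewrite n0 in lx.
have x0 : C by case: s szs => [|c ? _]; [move=> e; rewrite -e in n_gt0|exact: c].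
exists [ffun x : 'I_n => nth x0 s x] => c.
rewrite col_count_count.
have -> : codom [ffun x : 'I_n => nth x0 s x] = s.
  apply: (@eq_from_nth _ x0); rewrite size_codom card_ord // => i li.
  rewrite codomE (nth_map (Ordinal li)) ?size_enum_ord // ffunE.
  by rewrite (nth_ord_enum _ (Ordinal li)).
rewrite count_flatten -map_comp sumnE big_map big_enum /= (bigD1 c) //=.
rewrite big1 ?addn0; last by move=> d dc; rewrite count_nseq /= (negPf dc).
by rewrite count_nseq /= eqxx mul1n.
Qed.

(** The permutations carrying [f] to the translate by [h0] form the coset of [h0] by the stabilizer
    of [f]. *)
Lemma card_translates f h0 :
  #|[set h : {perm 'I_n} | [ffun x => f (h x)] == [ffun x => f (h0 x)]]|
    = #|[set g | colfix f g]|.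
Proof.
rewrite -(card_imset [set g | colfix f g] (mulgI h0)).
apply: eq_card => h; rewrite !inE; apply/eqP/imsetP => [e|[g + ->]].
  exists (h0^-1 * h)%g; last by rewrite mulKVg.
  rewrite inE; apply/colfixP => x; rewrite permM.
  by have /ffunP /(_ (h0^-1 x)%g) := e; rewrite !ffunE permKV.
rewrite inE => /colfixP fg; apply/ffunP => x.
by rewrite !ffunE permM fg.
Qed.

Lemma card_stab_translate f h :
  #|[set g | colfix [ffun x => f (h x)] g]| = #|[set g | colfix f g]|.
Proof.
rewrite -(card_imset [set g | colfix f g] (@conjg_inj _ h^-1%g)).
apply: eq_card => g; rewrite !inE; apply/colfixP/imsetP => [fg|[g' + ->]].
  exists (g ^ h)%g; last by rewrite conjgK.
  rewrite inE; apply/colfixP => x; rewrite conjgE !permM.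
  by have := fg (h^-1 x)%g; rewrite !ffunE permKV.
rewrite inE => /colfixP fg x; rewrite !ffunE conjgE invgK !permM permKV.
by rewrite fg.
Qed.

(** Orbit counting: the colorings of content [A] form a single orbit, and the permutations leading
    from [f0] to any one of them are as many as its stabilizer. Together they exhaust S_n. *)
Lemma sum_card_stab (A : C -> nat) : (\sum_c A c)%N = n ->
  (\sum_(f | [forall c, col_count f c == A c]) #|[set g | colfix f g]|)%N = n`!.
Proof.
move=> /exists_coloring [f0 f0A].
rewrite -card_Sn -sum1_card.
rewrite (partition_big (fun h : {perm 'I_n} => [ffun x => f0 (h x)])
  (fun f => [forall c, col_count f c == A c])) /=; last first.
  by move=> h _; apply/forallP => c; rewrite col_count_perm f0A.
apply: eq_bigr => f /forallP fA.
have /col_count_transitive [h0 ->] : col_count f0 =1 col_count f.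
  by move=> c; rewrite f0A (eqP (fA c)).
by rewrite card_stab_translate -(card_translates f0 h0) sum1dep_card.
Qed.

End Colorings.

Section PermChar.
Variable N : nat.

Definition content n (f : {ffun 'I_n -> 'I_N}) : 'X_{1..N} :=
  [multinom col_count f i | i < N].

(* The value at g of the permutation character on the cosets of the Young
   subgroup of shape alpha. *)
Definition young_char n (alpha : 'X_{1..N}) (g : {perm 'I_n}) : nat :=
  #|[set f : {ffun 'I_n -> 'I_N} | colfix f g && (content f == alpha)]|.

Definition cycle_poly n (g : {perm 'I_n}) : {mpoly int[N]} :=
  \sum_(f : {ffun 'I_n -> 'I_N} | colfix f g) 'X_[content f].

Lemma mcoeff_cycle_poly n (g : {perm 'I_n}) alpha :
  (cycle_poly g)@_alpha = (young_char alpha g)%:R.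
Proof.
rewrite raddf_sum /= /young_char -sum1dep_card natr_sum big_mkcondr.
by apply: eq_bigr => f _; rewrite mcoeffX; case: eqP.
Qed.

Lemma mdeg_content n (f : {ffun 'I_n -> 'I_N}) : mdeg (content f) = n.
Proof.
rewrite mdegE -[RHS](sum_col_count f).
by apply: eq_bigr => i _; rewrite mnmE.
Qed.

(** A coloring is fixed by [g] exactly when it is constant on cycles, and expanding the product of
    power sums chooses one colour for each cycle. *)
Lemma prod_power_sum n (g : {perm 'I_n}) :
  \prod_(c in porbits g) power_sum N #|c| = cycle_poly g.
Proof.
rewrite /power_sum /cycle_poly.
have col_const (f : {ffun 'I_n -> 'I_N}) : colfix f g ->
    forall x y, y \in porbit g x -> f y = f x.
  move=> /colfixP fg x y /porbitP [i ->].
  by elim: i => [|i IH]; rewrite ?expg0 ?perm1 // expgSr permM fg.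
(* Distributing the product over the sums needs a default colour [i0]. Without colours, both sides
   are 1 if [n] is 0 and 0 otherwise. *)
have [N0|N_gt0] := posnP N.
  case: n g col_const => [|n] g _; last first.
    rewrite (bigD1 (porbit g ord0)) /=; last exact: imset_f.
    rewrite [X in X * _]big1 ?mul0r; last by case=> i li; exfalso; rewrite N0 in li.
    by rewrite big1 // => f _; exfalso; case: (f ord0) => i; rewrite N0.
  rewrite big_pred0 => [|c]; last by apply/imsetP => -[[]].
  rewrite (big_pred1 (ffun0 (card_ord 0))) => [|f]; last first.
    have -> : f = ffun0 (card_ord 0) by apply/ffunP => -[].
    by rewrite /= eqxx; apply/colfixP => -[].
  rewrite (_ : content _ = 0%MM) ?mpolyX0 //.
  by apply/mnmP => -[i li]; exfalso; rewrite N0 in li.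
pose i0 := Ordinal N_gt0.
rewrite (big_distr_big_dep i0 (mem (porbits g)) (fun _ _ => true)) /=.
pose up (F : {ffun {set 'I_n} -> 'I_N}) := [ffun x => F (porbit g x)].
pose down (f : {ffun 'I_n -> 'I_N}) : {ffun {set 'I_n} -> 'I_N} :=
  [ffun c : {set 'I_n} => if c \in porbits g
     then (if [pick x in c] is Some x then f x else i0) else i0].
rewrite (reindex_onto down up) /=; last first.
  move=> F /pfamilyP [sF _]; apply/ffunP => c; rewrite ffunE.
  case: ifPn => [/imsetP [x _ ->]|cg].
    case: pickP => [y|/(_ x)]; last by rewrite porbit_id.
    by rewrite ffunE /= -eq_porbit_mem => /eqP ->.
  apply/esym/eqP; apply: contraNT cg => Fc; apply: (subsetP sF).
  by rewrite !inE.
have downx (f : {ffun 'I_n -> 'I_N}) x : colfix f g -> down f (porbit g x) = f x.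
  move=> fg; rewrite ffunE imset_f //.
  case: pickP => [y|/(_ x)]; last by rewrite porbit_id.
  exact: col_const.
apply: eq_big => [f|f /andP [_ /eqP updown]].
  apply/andP/idP => [[_ /eqP <-]|fg].
    apply/colfixP => x; rewrite !ffunE.
    suff -> : porbit g (g x) = porbit g x by [].
    by apply/eqP; rewrite eq_porbit_mem -[g]expg1 mem_porbit.
  split; last by apply/eqP/ffunP => x; rewrite ffunE downx.
  apply/pfamilyP; split=> //; apply/subsetP => c; rewrite !inE ffunE.
  by case: ifP => // _; rewrite eqxx.
have fg : colfix f g.
  rewrite -updown; apply/colfixP => x; rewrite !ffunE.
  suff -> : porbit g (g x) = porbit g x by [].
  by apply/eqP; rewrite eq_porbit_mem -[g]expg1 mem_porbit.
rewrite mprodXnE; congr 'X_[_].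
apply/mnmP => i; rewrite mnm_sumE mnmE /col_count -sum1_card.
rewrite (partition_big (porbit g) (mem (porbits g))) /=; last first.
  by move=> x _; apply: imset_f.
apply: eq_bigr => c /imsetP [x _ ->]; rewrite mulmnE mnm1E downx //.
rewrite sum1dep_card; case: eqP => [<-|fxi].
  rewrite mul1n; apply: eq_card => y; rewrite !inE eq_porbit_mem porbit_sym.
  by apply/idP/andP => [yx|[]//]; rewrite (col_const f fg y x) // eqxx.
rewrite mul0n; apply/esym/eq_card0 => y; rewrite !inE.
apply/andP => -[/eqP fy]; rewrite eq_porbit_mem porbit_sym => yx.
by case: fxi; rewrite (col_const f fg y x).
Qed.

Definition dperm (w : {perm 'I_N}) : 'X_{1..N} := [multinom (N - 1 - w i)%N | i < N].

Lemma vandermondeE :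
  vandermonde N = \sum_(w : {perm 'I_N}) (-1) ^+ w *: 'X_[dperm w].
Proof.
(* The Vandermonde determinant multiplies the differences a_j - a_i for i < j; reversing the
   variables turns them into x_i - x_j. The matching conjugation of permutations by the reversal
   keeps signs. *)
pose a : 'rV[{mpoly int[N]}]_N := \row_j 'X_(rev_ord j).
have -> : vandermonde N = \det (Vandermonde N a).
  rewrite det_Vandermonde /vandermonde.
  rewrite (reindex_inj rev_ord_inj) /=.
  under eq_bigr do rewrite (reindex_inj rev_ord_inj) /=.
  rewrite (exchange_big_dep predT) //=; apply: eq_bigr => i _.
  apply: eq_big => [j|j _]; last by rewrite !mxE.
  by have := ltn_ord i; have := ltn_ord j; lia.
rewrite -det_tr [LHS]/determinant.
pose r := perm (@rev_ord_inj N).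
have r2 : (r * r = 1)%g by apply/permP => i; rewrite permM !permE rev_ordK.
have rV : (r^-1 = r)%g by rewrite -[RHS]mul1g -(mulVg r) -mulgA r2 mulg1.
rewrite (reindex_inj (@conjg_inj _ r)) /=; apply: eq_bigr => w _.
rewrite odd_permJ mulr_sign scaler_sign.
suff -> : \prod_i (Vandermonde N a)^T i ((w ^ r)%g i) = 'X_[dperm w] by [].
rewrite (reindex_inj rev_ord_inj) /= mpolyXE_id; apply: eq_bigr => i _.
rewrite !mxE rev_ordK mnmE conjgE rV !permM !permE /= rev_ordK.
by rewrite -subnDA add1n.
Qed.

End PermChar.

Section CompleteHomogeneous.
Variable N : nat.

(** The complete homogeneous symmetric polynomial h_b. The bound [B] only makes the set of monomials
    finite: any [B] that is at least [b] gives the same polynomial. *)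
Definition hpol (B b : nat) : {mpoly int[N]} :=
  \sum_(a : 'X_{1..N < B.+1} | mdeg a == b) 'X_[a].

Lemma mcoeff_hpol B b m : (b <= B)%N -> (hpol B b)@_m = (mdeg m == b)%:R.
Proof.
move=> bB; rewrite raddf_sum /=.
under eq_bigr do rewrite mcoeffX.
case: eqP => [mb|mb].
  have mB : (mdeg m < B.+1)%N by rewrite mb.
  rewrite (bigD1 (BMultinom mB)) /=; last by rewrite mb.
  rewrite eqxx big1 ?addr0 // => a /andP [_ /negPf am].
  by rewrite -[m]/(bmnm (BMultinom mB)) (inj_eq val_inj) am.
by rewrite big1 // => a /eqP ab; case: eqP => // am; rewrite am in ab.
Qed.

(** Two colorings fixed by [g] are one coloring by pairs of colours, whose content is an N' x N
    matrix with row sums [beta]. By orbit counting each matrix contributes n! times the monomial of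
    its column sums, and these matrices are the terms in the expansion of the product of the
    h_(beta_j). *)
Lemma sum_young_char_cycle_poly N' n (beta : 'X_{1..N'}) : mdeg beta = n ->
  \sum_(g : {perm 'I_n}) (young_char beta g)%:R *: cycle_poly N g
    = n`!%:R *: \prod_(j < N') hpol n (beta j).
Proof.
move=> beta_n.
pose stab2 (f : {ffun 'I_n -> 'I_N'}) (f' : {ffun 'I_n -> 'I_N}) :=
  #|[set g | colfix f g && colfix f' g]|.
transitivity (\sum_(f : {ffun 'I_n -> 'I_N'} | content f == beta)
    \sum_(f' : {ffun 'I_n -> 'I_N}) 'X_[content f'] *+ stab2 f f'
    : {mpoly int[N]}).
  transitivity (\sum_(g : {perm 'I_n})
     \sum_(f : {ffun 'I_n -> 'I_N'} | colfix f g && (content f == beta))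
     cycle_poly N g).
    apply: eq_bigr => g _; rewrite /young_char -sum1dep_card natr_sum scaler_suml.
    by apply: eq_bigr => f _; rewrite scale1r.
  rewrite (exchange_big_dep (fun f => content f == beta)) /=; last first.
    by move=> g f _ /andP [].
  apply: eq_bigr => f fb; rewrite (exchange_big_dep predT) //=.
  apply: eq_bigr => f' _; rewrite sumr_const; congr (_ *+ _).
  by apply: eq_card => g; rewrite !inE unfold_in fb andbT.
pose split2 (F : {ffun 'I_n -> 'I_N' * 'I_N}) :=
  ([ffun x => (F x).1] : {ffun 'I_n -> 'I_N'},
   [ffun x => (F x).2] : {ffun 'I_n -> 'I_N}).
pose join2 (p : {ffun 'I_n -> 'I_N'} * {ffun 'I_n -> 'I_N}) :
  {ffun 'I_n -> 'I_N' * 'I_N} := [ffun x => (p.1 x, p.2 x)].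
rewrite pair_big_dep (reindex split2) /=; last first.
  exists join2 => [F _|[f f'] _]; first by apply/ffunP => x; rewrite !ffunE -surjective_pairing.
  by congr (_, _); apply/ffunP => x; rewrite !ffunE.
have count1 F j : col_count (split2 F).1 j = (\sum_i col_count F (j, i))%N.
  rewrite /col_count -sum1_card (partition_big (fun x => (F x).2) predT) //=.
  apply: eq_bigr => i _; rewrite sum1dep_card; apply: eq_card => x.
  by rewrite !inE ffunE; case: (F x).
have count2 F i : col_count (split2 F).2 i = (\sum_j col_count F (j, i))%N.
  rewrite /col_count -sum1_card (partition_big (fun x => (F x).1) predT) //=.
  apply: eq_bigr => j _; rewrite sum1dep_card; apply: eq_card => x.
  by rewrite !inE ffunE; case: (F x) => a b /=; rewrite xpair_eqE andbC.
have rowP (F : {ffun 'I_n -> 'I_N' * 'I_N}) (j : 'I_N') :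
  (mdeg [multinom col_count F (j, i) | i < N] < n.+1)%N.
  rewrite mdegE; under eq_bigr do rewrite mnmE.
  rewrite -count1 ltnS -[X in (_ <= X)%N](sum_col_count (split2 F).1).
  by rewrite (bigD1 j) //= leq_addr.
pose rows (F : {ffun 'I_n -> 'I_N' * 'I_N}) : {ffun 'I_N' -> 'X_{1..N < n.+1}} :=
  [ffun j => BMultinom (rowP F j)].
have mdeg_rows F j : mdeg (rows F j) = content (split2 F).1 j.
  rewrite ffunE mdegE /=; under eq_bigr do rewrite mnmE.
  by rewrite mnmE count1.
rewrite bigA_distr_big_dep scaler_sumr.
rewrite (partition_big rows
  (fun A => A \in family (fun j a => mdeg (bmnm a) == beta j))) /=; last first.
  move=> F; rewrite andbT => /eqP Fb; apply/familyP => j.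
  by rewrite unfold_in mdeg_rows Fb.
apply: eq_bigr => A /familyP Ab.
have sumA : (\sum_(c : 'I_N' * 'I_N) A c.1 c.2)%N = n.
  rewrite -(pair_bigA _ (fun j i => A j i)) /= -[RHS]beta_n mdegE.
  apply: eq_bigr => j _; have := Ab j; rewrite unfold_in => /eqP <-.
  by rewrite mdegE.
have rowsE F j i : rows F j i = col_count F (j, i) by rewrite ffunE /= mnmE.
rewrite mprodXE -(sum_card_stab sumA) natr_sum scaler_suml.
apply: eq_big => [F|F /andP [_ /eqP FA]].
  rewrite andbT; apply/andP/forallP => [[_ /eqP <-] [j i]|FA].
    by rewrite rowsE.
  have rowsA : rows F = A.
    apply/ffunP => j; apply/val_inj/mnmP => i /=; rewrite rowsE.
    by rewrite (eqP (FA (j, i))).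
  split; last by rewrite rowsA.
  apply/eqP/mnmP => j; rewrite -mdeg_rows rowsA.
  by have := Ab j; rewrite unfold_in => /eqP.
rewrite scaler_nat; congr ('X_[_] *+ _).
  apply/mnmP => i; rewrite mnm_sumE mnmE count2.
  by apply: eq_bigr => j _; rewrite -FA rowsE.
apply: eq_card => g; rewrite !inE; apply/andP/colfixP => [[] |Fg].
  move=> /colfixP f1 /colfixP f2 x; move: (f1 x) (f2 x); rewrite !ffunE.
  by case: (F x) => a b; case: (F (g x)) => a' b' /= -> ->.
by split; apply/colfixP => x; rewrite !ffunE Fg.
Qed.

End CompleteHomogeneous.

(** * Pieri's rule and Kostka numbers *)

Section Alternating.
Variable N : nat.
Implicit Types (P : {mpoly int[N]}) (u v m : 'X_{1..N}).

Definition mperm m (s : {perm 'I_N}) : 'X_{1..N} := [multinom m (s i) | i < N].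

Definition alternating P : Prop :=
  forall m (s : {perm 'I_N}), P@_(mperm m s) = (-1) ^+ s * P@_m.

Definition symmetric_poly P : Prop :=
  forall m (s : {perm 'I_N}), P@_(mperm m s) = P@_m.

Lemma alternatingM P Q : alternating P -> symmetric_poly Q -> alternating (P * Q).
Proof.
move=> altP symQ m s; rewrite -!mcoeff_sym msymM.
have -> : msym s P = (-1) ^+ s *: P.
  by apply/mpolyP => m'; rewrite mcoeff_sym mcoeffZ altP.
have -> : msym s Q = Q by apply/mpolyP => m'; rewrite mcoeff_sym symQ.
by rewrite -scalerAl mcoeffZ.
Qed.

Lemma symmetricM P Q :
  symmetric_poly P -> symmetric_poly Q -> symmetric_poly (P * Q).
Proof.
move=> symP symQ m s; rewrite -!mcoeff_sym msymM.
have -> : msym s P = P by apply/mpolyP => m'; rewrite mcoeff_sym symP.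
by have -> : msym s Q = Q by apply/mpolyP => m'; rewrite mcoeff_sym symQ.
Qed.

Lemma symmetric1 : symmetric_poly 1.
Proof. by move=> m s; rewrite -mcoeff_sym msym1. Qed.

Lemma symmetric_hpol B b : (b <= B)%N -> symmetric_poly (hpol N B b).
Proof. by move=> bB m s; rewrite !mcoeff_hpol // mdeg_mperm. Qed.

Lemma alternating_vandermonde : alternating (vandermonde N).
Proof.
move=> m s; rewrite vandermondeE !raddf_sum mulr_sumr /=.
rewrite (reindex_inj (mulgI s)) /=; apply: eq_bigr => w _.
rewrite !mcoeffZ !mcoeffX odd_permM signr_addb mulrA; congr (_ * _%:R).
congr (nat_of_bool _); apply/eqP/eqP => [/mnmP e|<-]; apply/mnmP => i.
  by have := e (s^-1 i)%g; rewrite !mnmE permM permKV.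
by rewrite !mnmE permM.
Qed.

Lemma alternating_eq0 P m i j : alternating P -> i != j -> m i = m j -> P@_m = 0.
Proof.
move=> altP ij mij.
have := altP m (tperm i j); rewrite odd_tperm ij expr1 mulN1r.
have -> : mperm m (tperm i j) = m.
  by apply/mnmP => k; rewrite mnmE; case: tpermP => [->|->|//].
lia.
Qed.

Definition strict_dec m : Prop := forall i j : 'I_N, (i < j)%N -> (m j < m i)%N.

(** Inverse of lambda |-> lambda + delta. The truncation of the subtraction is harmless for strictly
    decreasing [m], by [strict_dec_ge]. *)
Definition vpart m (i : nat) : nat := (nth 0 m i - (N - 1 - i))%N.

Lemma nth_mnm m (i : 'I_N) : nth 0%N m i = m i.
Proof. by rewrite (mnm_nth 0). Qed.

Lemma nth_mnm_default m i : (N <= i)%N -> nth 0%N m i = 0%N.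
Proof. by move=> Ni; rewrite nth_default // size_tuple. Qed.

Lemma strict_dec_nth m i j : strict_dec m -> (i < j)%N -> (j < N)%N ->
  (nth 0 m j < nth 0 m i)%N.
Proof.
move=> dm ij jN; have iN := ltn_trans ij jN.
by have := dm (Ordinal iN) (Ordinal jN) ij; rewrite -!nth_mnm.
Qed.

Lemma strict_dec_ge m i : strict_dec m -> (i < N)%N -> (N - 1 - i <= nth 0 m i)%N.
Proof.
move=> dm iN; have [k ek] : exists k, (N - 1 - i)%N = k by exists (N - 1 - i)%N.
rewrite ek; elim: k i iN ek => [//|k IH] i iN ek.
have i1N : (i.+1 < N)%N by lia.
have ek' : (N - 1 - i.+1)%N = k by lia.
by have := IH _ i1N ek'; have := strict_dec_nth dm (ltnSn i) i1N; lia.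
Qed.

Lemma strict_dec_le m i : strict_dec m -> (i < N)%N -> (nth 0 m i + i <= nth 0 m 0)%N.
Proof.
move=> dm; elim: i => [|i IH] iN; first by rewrite addn0.
have := IH (ltnW iN); have := strict_dec_nth dm (ltnSn i) iN; lia.
Qed.

Lemma mdeg_nth m : mdeg m = (\sum_(0 <= i < N) nth 0 m i)%N.
Proof. by rewrite mdegE big_mkord; apply: eq_bigr => i _; rewrite nth_mnm. Qed.

Lemma mdeg_vpart m : strict_dec m ->
  mdeg m = (\sum_(0 <= i < N) vpart m i + \sum_(0 <= i < N) (N - 1 - i))%N.
Proof.
move=> dm; rewrite mdeg_nth -big_split /=; apply: eq_big_nat => i /= iN.
by rewrite /vpart subnK // strict_dec_ge.
Qed.

Lemma sum_vpart_le m r : (\sum_(0 <= i < r) vpart m i <= \sum_(0 <= i < N) vpart m i)%N.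
Proof.
have [rN|Nr] := leqP r N; first by rewrite [leqRHS](big_cat_nat (n := r)) //= leq_addr.
rewrite (big_cat_nat (n := N)) //=; last exact: ltnW.
rewrite [X in (_ + X)%N]big_nat_cond [X in (_ + X)%N]big1 ?addn0 // => i.
by rewrite andbT => /andP [Ni _]; rewrite /vpart nth_mnm_default.
Qed.

Lemma sum_vpart_stable m s r : (forall i, (s <= i)%N -> vpart m i = 0%N) ->
  (s <= r)%N -> (\sum_(0 <= i < r) vpart m i = \sum_(0 <= i < N) vpart m i)%N.
Proof.
move=> m0 sr; apply/eqP; rewrite eqn_leq sum_vpart_le /=.
have [Nr|rN] := leqP N r; first by rewrite [leqRHS](big_cat_nat (n := N)) //= leq_addr.
rewrite (big_cat_nat (n := r)) ?(ltnW rN) //= [X in (_ + X)%N]big_nat_cond.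
rewrite [X in (_ + X)%N]big1 ?addn0 // => i /andP [/andP [ri _] _].
by rewrite m0 // (leq_trans sr).
Qed.

(** For v = lambda + delta and u = mu + delta, the horizontal strip condition lambda_(i+1) <= mu_i
    becomes v_(i+1) < u_i, because delta drops by one; this is its negation. *)
Definition hstrip_fail_at v u (i : nat) : bool :=
  (i.+1 < N)%N && (nth 0 u i <= nth 0 v i.+1)%N.

Definition hstrip_fail v u : bool := has (hstrip_fail_at v u) (iota 0 N).

Lemma find_iota (a : pred nat) i : (i < N)%N -> a i ->
  (forall j, (j < i)%N -> ~~ a j) -> find a (iota 0 N) = i.
Proof.
move=> iN ai nai; have ha : has a (iota 0 N).
  by apply/hasP; exists i => //; rewrite mem_iota.
have fN : (find a (iota 0 N) < N)%N by rewrite has_find size_iota in ha.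
apply/eqP; rewrite eqn_leq; apply/andP; split; rewrite leqNgt; apply/negP => lt.
  by have := before_find 0 lt; rewrite nth_iota // add0n ai.
by have /negP := nai _ lt; apply; have := nth_find 0 ha; rewrite nth_iota.
Qed.

End Alternating.

(* The sign-reversing involution behind Pieri's rule: exchange the entries of u
   at the first position where v / u fails to be a horizontal strip. *)
Lemma sum_hstrip_fail_eq0 N D (P : {mpoly int[N]}) v b : alternating P -> strict_dec v ->
  \sum_(u : 'X_{1..N < D} | ((u <= v)%MM && (mdeg u + b == mdeg v)%N) && hstrip_fail v u)
     P@_u = 0.
Proof.
case: N P v => [|p] P v altP dv.
  by rewrite big_pred0 // => u; rewrite /hstrip_fail /= andbF.
pose ib (u : 'X_{1..p.+1}) := find (hstrip_fail_at v u) (iota 0 p.+1).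
pose tr (u : 'X_{1..p.+1}) : {perm 'I_p.+1} := tperm (inord (ib u)) (inord (ib u).+1).
have tauP (u : 'X_{1..p.+1 < D}) : (mdeg (mperm u (tr u)) < D)%N.
  by rewrite mdeg_mperm bmdeg.
pose tau u := BMultinom (tauP u).
pose Q (u : 'X_{1..p.+1 < D}) :=
  ((u <= v)%MM && (mdeg u + b == mdeg v)%N) && hstrip_fail v u.
have key u : Q u -> [/\ Q (tau u), tau (tau u) = u & P@_(tau u) = - P@_u].
  case/andP => /andP [/mnm_lepP uv du] bu.
  have ibN : (ib u < p.+1)%N by rewrite /ib -[X in (_ < X)%N](size_iota 0 p.+1) -has_find.
  have /andP [ib1 ubad] : hstrip_fail_at v u (ib u).
    by have := nth_find 0 bu; rewrite nth_iota.
  have iE : nat_of_ord (inord (ib u) : 'I_p.+1) = ib u by rewrite inordK.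
  have i1E : nat_of_ord (inord (ib u).+1 : 'I_p.+1) = (ib u).+1 by rewrite inordK.
  have ne : (inord (ib u) : 'I_p.+1) != inord (ib u).+1.
    by apply/eqP => /(congr1 val) /=; rewrite iE i1E; lia.
  have tauE i : tau u i = u (tr u i) by rewrite mnmE.
  have tauL : tau u (inord (ib u)) = u (inord (ib u).+1) by rewrite tauE tpermL.
  have tauR : tau u (inord (ib u).+1) = u (inord (ib u)) by rewrite tauE tpermR.
  have tauO i : i != inord (ib u) -> i != inord (ib u).+1 -> tau u i = u i.
    by move=> h1 h2; rewrite tauE tpermD // eq_sym.
  have ubad' : (u (inord (ib u)) <= v (inord (ib u).+1))%N.
    by rewrite -!nth_mnm iE i1E.
  have vv : (v (inord (ib u).+1) < v (inord (ib u)))%N by apply: dv; rewrite iE i1E.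
  (* Failure at [i] depends on [u] through u_i only, so the exchange leaves positions before [ib u]
     alone. At [ib u] the new entry is u_(ib+1) <= v_(ib+1), again a failure. Hence the first
     failure does not move and [tau] is an involution. *)
  have tau_bad_at i : (i < ib u)%N -> hstrip_fail_at v (tau u) i = hstrip_fail_at v u i.
    move=> ltib; have iN : (i < p.+1)%N by lia.
    rewrite /hstrip_fail_at -[i]/(nat_of_ord (Ordinal iN)) !(nth_mnm _ (Ordinal iN)).
    rewrite tauO //; apply/eqP => /(congr1 val) /=; rewrite ?iE ?i1E; lia.
  have tau_bad : hstrip_fail_at v (tau u) (ib u).
    have nth_ib (x : 'X_{1..p.+1}) : nth 0%N x (ib u) = x (inord (ib u)).
      by rewrite -nth_mnm iE.
    have nth_ib1 (x : 'X_{1..p.+1}) : nth 0%N x (ib u).+1 = x (inord (ib u).+1).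
      by rewrite -nth_mnm i1E.
    apply/andP; split=> //; rewrite nth_ib nth_ib1 tauL.
    by have := uv (inord (ib u).+1); lia.
  have ib_tau : ib (tau u) = ib u.
    apply: find_iota => // j ltj; rewrite tau_bad_at //; apply/negP => bj.
    have := before_find 0 ltj; rewrite nth_iota ?add0n ?bj //; lia.
  split; last 1 first.
  - by rewrite altP odd_tperm ne expr1 mulN1r.
  - apply/andP; split; last first.
      by apply/hasP; exists (ib u) => //; rewrite mem_iota.
    apply/andP; split; last by rewrite mdeg_mperm.
    apply/mnm_lepP => i; have [->|ni] := eqVneq i (inord (ib u)).
      by rewrite tauL; have := uv (inord (ib u).+1); lia.
    have [->|ni1] := eqVneq i (inord (ib u).+1); first by rewrite tauR.
    by rewrite tauO.
  apply/val_inj/mnmP => i /=; rewrite !mnmE /tr ib_tau.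
  by rewrite -/(tr u) tpermK.
set S := (LHS); have SN : S = - S.
  rewrite {1}/S (reindex_onto tau tau) /=; last by move=> u /key [].
  rewrite /S -sumrN; apply: eq_big => [u|u /andP [Qtu /eqP tt]].
    apply/andP/idP => [[Qtu /eqP tt]|/key [Qtu tt _]].
      by have [+ _ _] := key (tau u) Qtu; rewrite tt.
    by rewrite tt.
  by have [+ _ _] := key (tau u) Qtu; rewrite tt => /key [_ _ e]; exact: e.
by lia.
Qed.

(** The plain expansion runs over all [u] below [v] of the right degree; the sign-reversing
    involution cancels those that do not give a horizontal strip. *)
Lemma pieri N B b (P : {mpoly int[N]}) v :
  (b <= B)%N -> alternating P -> strict_dec v ->
  (P * hpol N B b)@_v =
  \sum_(u : 'X_{1..N < (mdeg v).+1}
        | ((u <= v)%MM && (mdeg u + b == mdeg v)%N) && ~~ hstrip_fail v u) P@_u.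
Proof.
move=> bB altP dv.
rewrite [LHS](@mcoeff_poly_mul_lin _ _ P (hpol N B b) v (mdeg v).+1) //.
rewrite (eq_bigr (fun u : 'X_{1..N < (mdeg v).+1} =>
    if (mdeg u + b == mdeg v)%N then P@_u else 0)); last first.
  move=> u uv; rewrite mcoeff_hpol //.
  have <- : (mdeg (v - u)%MM == b) = (mdeg u + b == mdeg v)%N.
    have := congr1 mdeg (submK uv); rewrite mdegD; lia.
  by case: eqP; rewrite ?mulr1 ?mulr0.
rewrite -big_mkcondr (bigID (fun u : 'X_{1..N < _} => hstrip_fail v u)) /=.
by rewrite sum_hstrip_fail_eq0 // add0r.
Qed.

Section Kostka.
Variables (N B : nat).

(** By the bialternant formula for Schur polynomials, the coefficient at lambda + delta is the
    Kostka number of shape lambda and content [bs]. *)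
Definition kpoly (bs : seq nat) : {mpoly int[N]} :=
  vandermonde N * \prod_(b <- bs) hpol N B b.

Lemma kpoly_rcons bs b : kpoly (rcons bs b) = kpoly bs * hpol N B b.
Proof. by rewrite /kpoly -cats1 big_cat big_seq1 mulrA. Qed.

Lemma alternating_kpoly bs : all (leq^~ B) bs -> alternating (kpoly bs).
Proof.
move=> bsB; apply: alternatingM; first exact: alternating_vandermonde.
elim: bs bsB => [|b bs IH] /=; first by rewrite big_nil => _; apply: symmetric1.
by case/andP=> bB bsB; rewrite big_cons; apply: symmetricM;
  [apply: symmetric_hpol|apply: IH].
Qed.

Lemma pieri_strict (u v : 'X_{1..N}) : strict_dec v -> (u <= v)%MM -> ~~ hstrip_fail v u ->
  strict_dec u /\ (forall i, (i.+1 < N)%N -> (nth 0 v i.+1 < nth 0 u i)%N).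
Proof.
move=> dv /mnm_lepP uv nb.
have H i : (i.+1 < N)%N -> (nth 0 v i.+1 < nth 0 u i)%N.
  move=> i1; rewrite ltnNge; apply: contra nb => le; apply/hasP; exists i.
    by rewrite mem_iota /=; lia.
  by rewrite /hstrip_fail_at i1.
split=> // i j ij; apply: leq_ltn_trans (uv j) _.
have i1N : (i.+1 < N)%N by have := ltn_ord j; lia.
rewrite -!nth_mnm; apply: leq_ltn_trans (H _ i1N).
have [<- //|ne] := eqVneq (i.+1) j.
by apply/ltnW/strict_dec_nth => //; move/eqP: ne; lia.
Qed.

Lemma vpart_le (u v : 'X_{1..N}) i : (u <= v)%MM -> (vpart u i <= vpart v i)%N.
Proof.
move=> /mnm_lepP uv; rewrite /vpart leq_sub2r //.
have [iN|Ni] := ltnP i N; last by rewrite nth_mnm_default.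
by rewrite -[i]/(nat_of_ord (Ordinal iN)) !nth_mnm.
Qed.

(** Each factor adds a horizontal strip, hence opens at most one new row: after the first r factors,
    everything lies in the first r rows. The entries of [bs] may come in any order. *)
Lemma kostka_dominance bs v : all (leq^~ B) bs -> strict_dec v -> (kpoly bs)@_v != 0 ->
  (forall i, (size bs <= i)%N -> vpart v i = 0%N) /\
  (forall r, (\sum_(0 <= i < r) nth 0 bs i <= \sum_(0 <= i < r) vpart v i)%N).
Proof.
elim/last_ind: bs v => [|bs b IH] v.
  move=> _ dv; rewrite /kpoly big_nil mulr1 vandermondeE raddf_sum /= => nz.
  split=> [i _|r]; last by rewrite big1 // => i _; rewrite nth_nil.
  have [iN|Ni] := ltnP i N; last by rewrite /vpart nth_mnm_default.
  have [w vw] : exists w : {perm 'I_N}, v = dperm w.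
    suff /existsP [w /eqP] : [exists w : {perm 'I_N}, v == dperm w] by exists w.
    apply: contraNT nz => /existsPn vw.
    rewrite big1 // => w _; rewrite mcoeffZ mcoeffX eq_sym.
    by rewrite (negPf (vw w)) mulr0.
  have N_gt0 : (0 < N)%N by lia.
  have := strict_dec_le dv iN.
  rewrite -[X in (_ <= nth 0 v X)%N]/(nat_of_ord (Ordinal N_gt0)) (nth_mnm v).
  by rewrite {2}vw mnmE /vpart; lia.
rewrite all_rcons => /andP [bB bsB] dv.
rewrite kpoly_rcons pieri //; last exact: alternating_kpoly.
move=> nz.
have [u /andP [/andP [uv /eqP duv] nb] nzu] :
    exists2 u : 'X_{1..N < (mdeg v).+1},
      ((u <= v)%MM && (mdeg u + b == mdeg v)%N) && ~~ hstrip_fail v u & (kpoly bs)@_u != 0.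
  apply/exists_inP; apply: contraNT nz => /exists_inPn h.
  by rewrite big1 // => u /h; rewrite negbK => /eqP.
have [du uv1] := pieri_strict dv uv nb.
have [IH1 IH2] := IH _ bsB du nzu.
have P1 i : (size (rcons bs b) <= i)%N -> vpart v i = 0%N.
  rewrite size_rcons => si; have [iN|Ni] := ltnP i N; last first.
    by rewrite /vpart nth_mnm_default.
  case: i si iN => // i si iN.
  have := IH1 i si; have := uv1 _ iN; rewrite /vpart; lia.
split=> // r.
have [rs|sr] := leqP r (size bs).
  apply: (@leq_trans (\sum_(0 <= i < r) vpart u i)); last first.
    by apply: leq_sum => i _; apply: vpart_le.
  apply: leq_trans (IH2 r); rewrite leq_eqVlt; apply/orP; left; apply/eqP.
  by apply: eq_big_nat => i /andP [_ ir]; rewrite nth_rcons (leq_trans ir).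
(* Here [r] reaches past the last row, so the right-hand side is the whole size and it suffices to
   compare degrees. *)
rewrite (sum_vpart_stable P1) ?size_rcons //.
have := mdeg_vpart du; have := mdeg_vpart dv.
have := leq_trans (IH2 r) (sum_vpart_le u r).
have -> : (\sum_(0 <= i < r) nth 0 (rcons bs b) i
           = \sum_(0 <= i < r) nth 0 bs i + b)%N.
  rewrite (bigD1_seq (size bs)) ?iota_uniq ?mem_index_iota //=.
  rewrite [in RHS](bigD1_seq (size bs)) ?iota_uniq ?mem_index_iota //=.
  rewrite nth_rcons ltnn eqxx nth_default // add0n addnC; congr (_ + _)%N.
  apply: eq_bigr => i /negPf ni; rewrite nth_rcons ni.
  by case: ltnP => // le; rewrite nth_default.
lia.
Qed.

(** The only way to fill a shape with its own content removes the last row at each step, so a single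
    term [u0] of Pieri's rule survives. *)
Lemma kostka_diag bs (v : 'X_{1..N}) : all (leq^~ B) bs ->
  (forall i j, (i <= j)%N -> (nth 0 bs j <= nth 0 bs i)%N) ->
  (forall i, (N <= i)%N -> nth 0%N bs i = 0%N) ->
  (forall i : 'I_N, v i = nth 0%N bs i + (N - 1 - i))%N ->
  (kpoly bs)@_v = 1.
Proof.
elim/last_ind: bs v => [|bs b IH] v bsB dec bsN vE.
  rewrite /kpoly big_nil mulr1 vandermondeE raddf_sum /=.
  rewrite (bigD1 1%g) //= mcoeffZ mcoeffX odd_perm1 expr0 mul1r.
  have <- : dperm 1 = v by apply/mnmP => i; rewrite vE nth_nil mnmE perm1 add0n.
  rewrite eqxx big1 ?addr0 // => w w1; rewrite mcoeffZ mcoeffX.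
  case: eqP => [/mnmP e|]; last by rewrite mulr0.
  case/eqP: w1; apply/permP => i; apply/val_inj; have := e i.
  by rewrite !mnmE !perm1 /=; have := ltn_ord i; have := ltn_ord (w i); lia.
have dv : strict_dec v.
  by move=> i j ij; rewrite !vE; have := dec _ _ (ltnW ij); have := ltn_ord j; lia.
move: bsB; rewrite all_rcons => /andP [bB bsB].
rewrite kpoly_rcons pieri //; last exact: alternating_kpoly.
have nthbs i : nth 0%N bs i = (if (i < size bs)%N then nth 0 (rcons bs b) i else 0)%N.
  by case: ltnP => h; [rewrite nth_rcons h|rewrite nth_default].
pose u0 : 'X_{1..N} := [multinom (nth 0 bs i + (N - 1 - i))%N | i < N].
have u0v : (u0 <= v)%MM.
  by apply/mnm_lepP => i; rewrite mnmE vE nthbs; case: ifP => // _; rewrite leq_add2r.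
have du0 : (mdeg u0 + b = mdeg v)%N.
  rewrite !mdegE.
  have [sN|Ns] := ltnP (size bs) N; last first.
    have -> : b = 0%N by have := bsN _ Ns; rewrite nth_rcons ltnn eqxx.
    rewrite addn0; apply: eq_bigr => i _; rewrite mnmE vE nthbs.
    by rewrite (leq_trans (ltn_ord i) Ns).
  rewrite (bigD1 (Ordinal sN)) //= [in RHS](bigD1 (Ordinal sN)) //=.
  rewrite mnmE vE /= nth_rcons ltnn eqxx nth_default //.
  rewrite (eq_bigr (fun i => v i)) /=; first lia.
  move=> i ni; rewrite mnmE vE nth_rcons.
  case: ltnP => // le; rewrite nth_default //.
  by case: eqP => // e; case/eqP: ni; apply/val_inj.
have nb0 : ~~ hstrip_fail v u0.
  apply/hasPn => i _; apply/negP => /andP [i1N]; apply/negP; rewrite -ltnNge.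
  have iN : (i < N)%N by lia.
  have -> : nth 0%N u0 i = (nth 0 bs i + (N - 1 - i))%N.
    by rewrite -[i in LHS]/(nat_of_ord (Ordinal iN)) nth_mnm mnmE.
  have -> : nth 0%N v i.+1 = (nth 0 (rcons bs b) i.+1 + (N - 1 - i.+1))%N.
    by rewrite -[i.+1 in LHS]/(nat_of_ord (Ordinal i1N)) nth_mnm vE.
  rewrite nthbs.
  have := dec i i.+1 (leqnSn i).
  case: ifP => si; first lia.
  by rewrite [nth _ _ i.+1]nth_default ?size_rcons; lia.
have u0D : (mdeg u0 < (mdeg v).+1)%N by rewrite -du0; lia.
rewrite (bigD1 (BMultinom u0D)) /=; last by rewrite u0v du0 eqxx nb0.
rewrite IH //; first last.
- by move=> i; rewrite mnmE.
- by move=> i Ni; rewrite nthbs bsN // if_same.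
- move=> i j ij; rewrite !nthbs; case: ltnP => // js.
  by rewrite (leq_ltn_trans ij js) dec.
rewrite big1 ?addr0 // => u /andP [/andP [/andP [uv /eqP duv] nb] une].
(* A contributing [u] has its parts bounded above by containment in [v] and its partial sums bounded
   below by dominance; together these force [u0]. *)
apply/eqP; apply: contraNT une => nzu.
have [du uv1] := pieri_strict dv uv nb.
have [H1 H2] := kostka_dominance bsB du nzu.
have uvp i : (i < N)%N -> (i < size bs)%N -> (vpart u i <= nth 0 bs i)%N.
  move=> iN ibs; apply: leq_trans (vpart_le i uv) _.
  rewrite /vpart -[i in nth 0 v i]/(nat_of_ord (Ordinal iN)) nth_mnm vE /=.
  by rewrite nthbs ibs addnK.
have eqv r : (r <= N)%N -> (r <= size bs)%N -> forall i, (i < r)%N -> vpart u i = nth 0%N bs i.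
  move=> rN rs i ir; apply/eqP; rewrite eqn_leq uvp //=; try lia.
  rewrite leqNgt; apply/negP => lti.
  have := H2 r; rewrite leqNgt => /negP; apply.
  rewrite (bigD1_seq i) ?iota_uniq ?mem_index_iota //=.
  rewrite [X in (_ < X)%N](bigD1_seq i) ?iota_uniq ?mem_index_iota //=.
  rewrite -addSn leq_add // big_seq_cond [X in (_ <= X)%N]big_seq_cond.
  apply: leq_sum => k; rewrite mem_index_iota => /andP [/andP [_ kr] _].
  by apply: uvp; lia.
apply/eqP/val_inj/mnmP => i /=; rewrite mnmE.
have ge := strict_dec_ge du (ltn_ord i).
rewrite nth_mnm in ge.
have [ibs|sbi] := ltnP i (size bs).
  by rewrite -(eqv i.+1) // /vpart nth_mnm; lia.
rewrite nthbs ltnNge sbi /=.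
by have := H1 _ sbi; rewrite /vpart nth_mnm; lia.
Qed.

End Kostka.

(** * Frobenius characters: orthogonality, completeness, branching *)

(** Frobenius' formula with a free number of variables and a free exponent: restriction from S_n to
    S_k compares different numbers of variables, and straightening meets exponents that are not
    decreasing. *)
Definition frob_char N (v : 'X_{1..N}) n (g : {perm 'I_n}) : int :=
  (vandermonde N * cycle_poly N g)@_v.

Lemma ScharE n lam (g : {perm 'I_n}) : Schar lam g = frob_char (frob_exp n lam) g.
Proof. by rewrite /Schar prod_power_sum. Qed.

Lemma mcoeffXM N (P : {mpoly int[N]}) m v :
  ('X_[m] * P)@_v = if (m <= v)%MM then P@_(v - m) else 0.
Proof.
rewrite -commr_mpolyX; case: ifPn => [mv|nmv].
  by rewrite -{1}(submK mv) addmC mcoeffMX.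
apply/memN_msupp_eq0; rewrite (perm_mem (msuppMX _ _)).
apply: contra nmv => /mapP [m' _ ->]; apply/mnm_lepP => i.
by rewrite mnmDE leq_addr.
Qed.

(** The Jacobi-Trudi determinant at the level of characters, obtained by expanding the Vandermonde
    factor. *)
Lemma frob_charE N (v : 'X_{1..N}) n (g : {perm 'I_n}) : frob_char v g =
  \sum_(w : {perm 'I_N} | (dperm w <= v)%MM)
     (-1) ^+ w * (young_char (v - dperm w)%MM g)%:R.
Proof.
rewrite /frob_char vandermondeE mulr_suml raddf_sum /= [RHS]big_mkcond.
apply: eq_bigr => w _; rewrite -scalerAl mcoeffZ mcoeffXM.
by case: ifP => _; rewrite ?mulr0 // mcoeff_cycle_poly.
Qed.

Lemma young_charV N (a : 'X_{1..N}) n (g : {perm 'I_n}) :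
  young_char a g^-1 = young_char a g.
Proof.
apply: eq_card => f; rewrite !inE; congr (_ && _).
by apply/colfixP/colfixP => fg x; [rewrite -{2}[x](permK g) fg|rewrite -{2}[x](permKV g) fg].
Qed.

Lemma young_charJ N (a : 'X_{1..N}) n (g h : {perm 'I_n}) :
  young_char a (g ^ h) = young_char a g.
Proof.
rewrite /young_char.
have inj : injective (fun f : {ffun 'I_n -> 'I_N} => [ffun x => f (h x)]).
  move=> f f' /ffunP e; apply/ffunP => x; have := e (h^-1 x)%g.
  by rewrite !ffunE permKV.
rewrite -(card_imset _ inj); apply: eq_card => f; rewrite [RHS]inE.
apply/imsetP/idP => [[f' + ->]|/andP [fg /eqP fa]].
  rewrite inE => /andP [/colfixP fg /eqP <-]; apply/andP; split.
    apply/colfixP => x; rewrite !ffunE.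
    by have := fg (h x); rewrite conjgE !permM permK.
  by apply/eqP/mnmP => i; rewrite !mnmE col_count_perm.
exists [ffun x => f (h^-1 x)%g]; last by apply/ffunP => x; rewrite !ffunE permK.
rewrite inE; apply/andP; split; last first.
  by rewrite -fa; apply/eqP/mnmP => i; rewrite !mnmE col_count_perm.
apply/colfixP => x; rewrite !ffunE conjgE !permM permK.
by move/colfixP: fg => ->.
Qed.

Lemma frob_charV N (v : 'X_{1..N}) n (g : {perm 'I_n}) : frob_char v g^-1 = frob_char v g.
Proof. by rewrite !frob_charE; apply: eq_bigr => w _; rewrite young_charV. Qed.

Lemma frob_charJ N (v : 'X_{1..N}) n (g h : {perm 'I_n}) : frob_char v (g ^ h) = frob_char v g.
Proof. by rewrite !frob_charE; apply: eq_bigr => w _; rewrite young_charJ. Qed.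

Lemma symmetric_cycle_poly N n (g : {perm 'I_n}) : symmetric_poly (cycle_poly N g).
Proof.
move=> m s; rewrite !mcoeff_cycle_poly; congr (_%:R); rewrite /young_char.
have inj : injective (fun f : {ffun 'I_n -> 'I_N} => [ffun x => s (f x)]).
  move=> f f' /ffunP e; apply/ffunP => x; have := e x.
  by rewrite !ffunE => /perm_inj.
have cntE (f : {ffun 'I_n -> 'I_N}) i : col_count [ffun x => s (f x)] (s i) = col_count f i.
  by apply: eq_card => x; rewrite !inE ffunE (inj_eq perm_inj).
rewrite -(card_imset _ inj); apply: eq_card => f; rewrite [RHS]inE.
apply/imsetP/idP => [[f' + ->]|/andP [fg /eqP fa]].
  rewrite inE => /andP [/colfixP fg /eqP/mnmP fm]; apply/andP; split.
    by apply/colfixP => x; rewrite !ffunE fg.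
  apply/eqP/mnmP => i; have := fm (s^-1 i)%g; rewrite !mnmE permKV => <-.
  by rewrite -{1}[i](permKV s) cntE.
have fE : f = [ffun x => s ([ffun x => (s^-1 (f x))%g] x)].
  by apply/ffunP => x; rewrite !ffunE permKV.
exists [ffun x => (s^-1 (f x))%g] => //.
rewrite inE; apply/andP; split.
  by apply/colfixP => x; rewrite !ffunE; move/colfixP: fg => ->.
by apply/eqP/mnmP => i; rewrite !mnmE -fa mnmE [in RHS]fE cntE.
Qed.

Lemma alternating_frob_char N n (g : {perm 'I_n}) : alternating (vandermonde N * cycle_poly N g).
Proof.
exact: alternatingM (@alternating_vandermonde N) (@symmetric_cycle_poly N n g).
Qed.

Lemma sum_frob_char_young N N' (v : 'X_{1..N}) n (beta : 'X_{1..N'}) : mdeg beta = n ->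
  \sum_(g : {perm 'I_n}) frob_char v g * (young_char beta g)%:R
    = n`!%:R * (kpoly N n beta)@_v.
Proof.
move=> bn; rewrite /kpoly big_tuple.
under [X in _ = _ * (_ * X)@__]eq_bigr do rewrite -mnm_tnth.
rewrite -mcoeffZ scalerAr -(sum_young_char_cycle_poly N bn) mulr_sumr raddf_sum /=.
by apply: eq_bigr => g _; rewrite -scalerAr mcoeffZ mulrC.
Qed.

(** * Partitions and the orthogonality relations *)

Section Partitions.
Implicit Types (lam mu : seq nat).

Lemma is_partition_dec n lam : is_partition n lam ->
  forall i j, (i <= j)%N -> (nth 0 lam j <= nth 0 lam i)%N.
Proof.
case/and3P => srt _ _ i j ij.
have [js|sj] := ltnP j (size lam); last by rewrite nth_default.
have geq_tr : transitive geq by move=> x y z /= h1 h2; apply: leq_trans h2 h1.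
apply: (sorted_leq_nth geq_tr) => //; first exact: leqnn.
by rewrite inE; apply: leq_ltn_trans js.
Qed.

Lemma is_partition_size n lam : is_partition n lam -> (size lam <= n)%N.
Proof.
case/and3P => _ pos /eqP <-; elim: lam pos => //= x s IH /andP [x0 /IH].
lia.
Qed.

Lemma is_partition_sum n lam N : is_partition n lam -> (size lam <= N)%N ->
  (\sum_(0 <= i < N) nth 0 lam i)%N = n.
Proof.
case/and3P => _ _ /eqP <- sN; rewrite sumnE [RHS](big_nth 0%N).
rewrite (big_cat_nat (n := size lam)) //= [X in (_ + X)%N]big_nat_cond.
by rewrite [X in (_ + X)%N]big1 ?addn0 // => i /andP [/andP [si _] _]; rewrite nth_default.
Qed.

Lemma is_partition_eq n lam mu : is_partition n lam -> is_partition n mu ->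
  (forall i, nth 0%N lam i = nth 0%N mu i) -> lam = mu.
Proof.
move=> /and3P [_ p1 _] /and3P [_ p2 _] e.
have H (s t : seq nat) : all (fun x => 0 < x)%N s ->
    (forall i, nth 0%N s i = nth 0%N t i) -> (size s <= size t)%N.
  move=> ps est; rewrite leqNgt; apply/negP => lt.
  have := est (size t); rewrite [RHS]nth_default //.
  by move=> e0; have /allP /(_ _ (mem_nth 0%N lt)) := ps; rewrite e0.
apply: (@eq_from_nth _ 0%N) => //; apply/eqP.
by rewrite eqn_leq !H.
Qed.

Lemma frob_strict N n lam : is_partition n lam -> strict_dec (frob_exp N lam).
Proof.
move=> pl i j ij; rewrite !mnmE.
by have := is_partition_dec pl (ltnW ij); have := ltn_ord j; lia.
Qed.

Lemma vpart_frob N n lam i : is_partition n lam -> (size lam <= N)%N ->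
  vpart (frob_exp N lam) i = nth 0%N lam i.
Proof.
move=> pl sN; rewrite /vpart; have [iN|Ni] := ltnP i N; last first.
  by rewrite nth_mnm_default // nth_default // (leq_trans sN).
by rewrite -[i in nth 0 (frob_exp N lam) i]/(nat_of_ord (Ordinal iN)) nth_mnm mnmE /= addnK.
Qed.

Lemma mdeg_frob N n lam : is_partition n lam -> (size lam <= N)%N ->
  mdeg (frob_exp N lam) = (n + \sum_(0 <= i < N) (N - 1 - i))%N.
Proof.
move=> pl sN; rewrite (mdeg_vpart (frob_strict pl)); congr (_ + _)%N.
rewrite -[RHS](is_partition_sum pl sN); apply: eq_big_nat => i _.
by rewrite (vpart_frob _ pl).
Qed.

Lemma mdeg_dperm N (w : {perm 'I_N}) : mdeg (dperm w) = (\sum_(0 <= i < N) (N - 1 - i))%N.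
Proof.
rewrite mdegE big_mkord [RHS](reindex_inj (@perm_inj _ w)) /=.
by apply: eq_bigr => i _; rewrite mnmE.
Qed.

(** [a] is at least [mu] in the lexicographic order: indices beyond the first difference are
    unconstrained. *)
Definition first_diff_ge (a mu : nat -> nat) :=
  forall i, (forall j, (j < i)%N -> a j = mu j) -> (mu i <= a i)%N.

(** Once all earlier entries agree, dominance and lexicographic order close the cycle lam_i >= a_i
    >= mu_i >= b_i >= lam_i. *)
Lemma first_diff_dominance (a b lam mu : nat -> nat) :
  first_diff_ge a mu -> first_diff_ge b lam ->
  (forall r, \sum_(0 <= i < r) a i <= \sum_(0 <= i < r) lam i)%N ->
  (forall r, \sum_(0 <= i < r) b i <= \sum_(0 <= i < r) mu i)%N ->
  forall i, lam i = mu i /\ a i = mu i.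
Proof.
move=> fa fb sa sb.
have H i : [/\ lam i = mu i, a i = mu i & b i = lam i].
  elim/ltn_ind: i => i IH.
  have a1 : (a i <= lam i)%N.
    have := sa i.+1; rewrite !big_nat_recr //=.
    rewrite (eq_big_nat _ _ (F2 := lam)) ?leq_add2l // => j /andP [_ /IH [e1 e2 _]].
    by rewrite e1 e2.
  have b1 : (b i <= mu i)%N.
    have := sb i.+1; rewrite !big_nat_recr //=.
    rewrite (eq_big_nat _ _ (F2 := mu)) ?leq_add2l // => j /andP [_ /IH [e1 _ e2]].
    by rewrite e2 e1.
  have a2 : (mu i <= a i)%N by apply: fa => j /IH [].
  have b2 : (lam i <= b i)%N by apply: fb => j /IH [].
  by split; lia.
by move=> i; have [] := H i.
Qed.

Lemma nth_frob_sub N n lam (w : {perm 'I_N}) (i : 'I_N) :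
  is_partition n lam -> (dperm w <= frob_exp N lam)%MM ->
  (nth 0 (frob_exp N lam - dperm w)%MM i + i = nth 0 lam i + w i)%N.
Proof.
move=> pl /mnm_lepP /(_ i); rewrite nth_mnm mnmBE !mnmE.
by have := ltn_ord i; have := ltn_ord (w i); lia.
Qed.

(** The i-th entry is lam_i + w(i) - i. Agreement with [lam] before [i] means that [w] fixes those
    indices, and then w(i) >= i by injectivity. *)
Lemma first_diff_frob N n lam (w : {perm 'I_N}) : is_partition n lam ->
  (size lam <= N)%N -> (dperm w <= frob_exp N lam)%MM ->
  first_diff_ge (nth 0%N (frob_exp N lam - dperm w)%MM) (nth 0%N lam).
Proof.
move=> pl sN wl i ih; have [iN|Ni] := ltnP i N; last first.
  by rewrite [X in (X <= _)%N]nth_default // (leq_trans sN).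
have nE := fun j => @nth_frob_sub N n lam w j pl wl.
have wj (j : 'I_N) : (j < i)%N -> w j = j.
  by move=> ji; apply/val_inj; have := nE j; rewrite ih //=; lia.
have := nE (Ordinal iN) => /=.
suff : (i <= w (Ordinal iN))%N by lia.
rewrite leqNgt; apply/negP => lt; have := wj _ lt => /perm_inj /(congr1 val) /= e.
by rewrite e ltnn in lt.
Qed.

Lemma mdeg_frob_sub N n lam (w : {perm 'I_N}) : is_partition n lam ->
  (size lam <= N)%N -> (dperm w <= frob_exp N lam)%MM ->
  mdeg (frob_exp N lam - dperm w)%MM = n.
Proof.
move=> pl sN wl; have := congr1 mdeg (submK wl).
by rewrite mdegD mdeg_dperm (mdeg_frob pl sN) => /addIn.
Qed.

Lemma all_le_mdeg N (m : 'X_{1..N}) : all (leq^~ (mdeg m)) m.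
Proof.
apply/allP => x /(nthP 0%N) [i]; rewrite size_tuple => iN <-.
rewrite -[i]/(nat_of_ord (Ordinal iN)) nth_mnm mdegE (bigD1 (Ordinal iN)) //=.
exact: leq_addr.
Qed.

Section Orthogonality.
Variables (n N N' : nat) (lam mu : seq nat).
Hypotheses (pl : is_partition n lam) (pm : is_partition n mu).
Hypotheses (sl : (size lam <= N)%N) (sm : (size mu <= N')%N).

Let dot := \sum_(g : {perm 'I_n}) frob_char (frob_exp N lam) g * frob_char (frob_exp N' mu) g.

Lemma dot_frob_charE : dot = n`!%:R *
  \sum_(w : {perm 'I_N'} | (dperm w <= frob_exp N' mu)%MM)
     (-1) ^+ w * (kpoly N n (frob_exp N' mu - dperm w)%MM)@_(frob_exp N lam).
Proof.
rewrite /dot mulr_sumr.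
under eq_bigr do rewrite [frob_char (frob_exp N' mu) _]frob_charE mulr_sumr.
rewrite exchange_big /=; apply: eq_bigr => w wm.
rewrite mulrCA -(sum_frob_char_young _ (mdeg_frob_sub pm sm wm)) mulr_sumr.
by apply: eq_bigr => g _; rewrite mulrCA.
Qed.

Lemma kostka_frob (w : {perm 'I_N'}) : (dperm w <= frob_exp N' mu)%MM ->
  (kpoly N n (frob_exp N' mu - dperm w)%MM)@_(frob_exp N lam) != 0 ->
  forall r, (\sum_(0 <= i < r) nth 0 (frob_exp N' mu - dperm w)%MM i
             <= \sum_(0 <= i < r) nth 0 lam i)%N.
Proof.
move=> wm nz r.
have bn : all (leq^~ n) (frob_exp N' mu - dperm w)%MM.
  by rewrite -[X in leq^~ X](mdeg_frob_sub pm sm wm) all_le_mdeg.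
have [_ /(_ r)] := kostka_dominance bn (frob_strict (N := N) pl) nz.
by rewrite [leqRHS](eq_bigr _ (fun i _ => vpart_frob i pl sl)).
Qed.

Lemma dot_frob_char_neq0 : dot != 0 -> exists w : {perm 'I_N'},
  (dperm w <= frob_exp N' mu)%MM /\
  forall r, (\sum_(0 <= i < r) nth 0 (frob_exp N' mu - dperm w)%MM i
             <= \sum_(0 <= i < r) nth 0 lam i)%N.
Proof.
rewrite dot_frob_charE mulf_eq0 negb_or => /andP [_ nz].
have [w wm nzw] : exists2 w : {perm 'I_N'}, (dperm w <= frob_exp N' mu)%MM &
    (kpoly N n (frob_exp N' mu - dperm w)%MM)@_(frob_exp N lam) != 0.
  apply/exists_inP; apply: contraNT nz => /exists_inPn h.
  by rewrite big1 // => w /h; rewrite negbK => /eqP ->; rewrite mulr0.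
by exists w; split=> //; apply: kostka_frob.
Qed.

End Orthogonality.

Lemma dot_frob_char n N N' lam mu : is_partition n lam -> is_partition n mu ->
  (size lam <= N)%N -> (size mu <= N')%N ->
  \sum_(g : {perm 'I_n}) frob_char (frob_exp N lam) g * frob_char (frob_exp N' mu) g
    = n`!%:R * (lam == mu)%:R.
Proof.
move=> pl pm sl sm; case: eqP => [e|ne]; last first.
  (* A nonzero product, expanded through [mu] and then symmetrically through [lam], gives dominance
     in both directions. *)
  rewrite mulr0; apply/eqP; case: eqP => // /eqP nz; case: ne.
  have [w [wm h]] := dot_frob_char_neq0 pl pm sl sm nz.
  move: nz; rewrite (eq_bigr _ (fun g _ => mulrC _ _)) => nz.
  have [w' [wl h']] := dot_frob_char_neq0 pm pl sm sl nz.
  apply: (is_partition_eq pl pm) => i.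
  have [] := first_diff_dominance (first_diff_frob pm sm wm)
     (first_diff_frob pl sl wl) h h' i.
  by [].
subst mu; rewrite (dot_frob_charE N lam pm sm) mulr1 -[RHS]mulr1; congr (_ * _).
have le1 : (dperm 1 <= frob_exp N' lam)%MM.
  by apply/mnm_lepP => i; rewrite !mnmE perm1 leq_addl.
have nth1 i : nth 0%N (frob_exp N' lam - dperm 1)%MM i = nth 0%N lam i.
  have [iN|Ni] := ltnP i N'; last by rewrite nth_mnm_default // nth_default // (leq_trans sm).
  have := nth_frob_sub (Ordinal iN) pl le1; rewrite perm1 /=; lia.
rewrite (bigD1 1%g) //= odd_perm1 expr0 mul1r.
rewrite kostka_diag; first last.
- by move=> i; rewrite mnmE nth1.
- by move=> i Ni; rewrite nth1 nth_default // (leq_trans sl).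
- by move=> i j ij; rewrite !nth1 (is_partition_dec pl).
- by rewrite -[X in leq^~ X](mdeg_frob_sub pl sm le1) all_le_mdeg.
rewrite big1 ?addr0 // => w /andP [wl w1].
have [->|nz] := eqVneq (kpoly N n (frob_exp N' lam - dperm w)%MM)@_(frob_exp N lam) 0.
  by rewrite mulr0.
have h := kostka_frob pl pm sl sm wl nz.
(* With [lam] in the roles of [b] and of both partitions, the cycle of inequalities forces lam +
   delta - w(delta) = lam, so [w] is the identity. *)
have fd0 : first_diff_ge (nth 0%N lam) (nth 0%N lam) by move=> i _.
have H := first_diff_dominance (first_diff_frob pl sm wl) fd0 h (fun r => leqnn _).
case/eqP: w1; apply/permP => i; apply/val_inj; rewrite perm1 /=.
have [_ e] := H i; have := nth_frob_sub i pl wl; rewrite e; lia.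
Qed.

Definition beta_shape N (v : 'X_{1..N}) : seq nat :=
  [seq x <- [seq vpart v i | i <- iota 0 N] | 0 < x]%N.

Lemma nth_filter_pos (s : seq nat) i : sorted geq s ->
  nth 0%N [seq x <- s | 0 < x]%N i = nth 0%N s i.
Proof.
have geq_tr : transitive geq by move=> x y z /= h1 h2; apply: leq_trans h2 h1.
elim: s i => //= x s IH i srt; have := path_sorted srt => ss.
case: posnP => [x0|x0]; last by case: i => //= i; apply: IH.
have s0 y : y \in s -> y = 0%N.
  by move=> ys; have /allP /(_ y ys) := order_path_min geq_tr srt; rewrite /= x0; lia.
rewrite (_ : [seq _ <- s | _] = [::]); last first.
  by apply/eqP; rewrite -[_ == _]negbK -has_filter; apply/hasPn => y /s0 ->.
rewrite nth_nil; case: i => [|i] /=; first by rewrite x0.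
have [lt|ge] := ltnP i (size s); last by rewrite nth_default.
by rewrite (s0 _ (mem_nth _ lt)).
Qed.

Lemma vpart_dec N (v : 'X_{1..N}) i : strict_dec v -> (vpart v i.+1 <= vpart v i)%N.
Proof.
move=> dv; rewrite /vpart; have [iN|Ni] := ltnP i.+1 N; last by rewrite nth_mnm_default.
have := strict_dec_nth dv (ltnSn i) iN; lia.
Qed.

Lemma beta_shape_sorted N (v : 'X_{1..N}) : strict_dec v ->
  sorted geq [seq vpart v i | i <- iota 0 N].
Proof.
move=> dv; apply/(sortedP 0%N) => i; rewrite size_map size_iota => iN.
by rewrite !(nth_map 0%N) ?size_iota ?nth_iota ?add0n //; [apply: vpart_dec|lia|lia].
Qed.

Lemma nth_beta_shape N (v : 'X_{1..N}) i : strict_dec v -> nth 0%N (beta_shape v) i = vpart v i.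
Proof.
move=> dv; rewrite nth_filter_pos; last exact: beta_shape_sorted.
have [iN|Ni] := ltnP i N; first by rewrite (nth_map 0%N) ?size_iota ?nth_iota ?add0n.
by rewrite nth_default ?size_map ?size_iota // /vpart nth_mnm_default.
Qed.

Lemma beta_shape_partition N n (v : 'X_{1..N}) : strict_dec v ->
  mdeg v = (n + \sum_(0 <= i < N) (N - 1 - i))%N -> is_partition n (beta_shape v).
Proof.
move=> dv dn; apply/and3P; split.
- apply: sorted_filter; last exact: beta_shape_sorted.
  by move=> x y z /= h1 h2; apply: leq_trans h2 h1.
- exact: filter_all.
rewrite sumnE big_filter.
have -> : (\sum_(i <- [seq vpart v i | i <- iota 0 N] | 0 < i) i)%N
         = (\sum_(0 <= i < N) vpart v i)%N.
  rewrite big_map /index_iota subn0 big_mkcond /=; apply: eq_bigr => i _.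
  by case: posnP.
by have := mdeg_vpart dv; rewrite dn => /addIn ->.
Qed.

Lemma size_beta_shape N (v : 'X_{1..N}) : (size (beta_shape v) <= N)%N.
Proof. by rewrite size_filter (leq_trans (count_size _ _)) // size_map size_iota. Qed.

Lemma frob_beta_shape N (v : 'X_{1..N}) : strict_dec v -> frob_exp N (beta_shape v) = v.
Proof.
move=> dv; apply/mnmP => i; rewrite mnmE nth_beta_shape // /vpart nth_mnm subnK //.
by rewrite -nth_mnm strict_dec_ge.
Qed.

End Partitions.

Definition strict_decb N (v : 'X_{1..N}) : bool :=
  [forall i : 'I_N, forall j : 'I_N, (i < j)%N ==> (v j < v i)%N].

Lemma strict_decP N (v : 'X_{1..N}) : reflect (strict_dec v) (strict_decb v).
Proof.
apply: (iffP idP) => [/forallP h i j ij|h].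
  by have /forallP /(_ j) := h i; rewrite ij.
by apply/forallP => i; apply/forallP => j; apply/implyP; apply: h.
Qed.

(** * Spanning and the decomposition of the regular character *)

Section Completeness.
Variable n : nat.

Let D := (\sum_(0 <= i < n) (n - 1 - i))%N.

(* Partitions of n are indexed by the exponents lambda + delta. *)
Definition beta_set : finType := 'X_{1..n < (n + D).+1}.

Definition is_beta (v : beta_set) : bool := strict_decb v && (mdeg v == n + D)%N.

Lemma is_betaP (v : beta_set) : is_beta v ->
  is_partition n (beta_shape v) /\ frob_exp n (beta_shape v) = v.
Proof.
case/andP => /strict_decP dv /eqP mv; split; first exact: beta_shape_partition.
exact: frob_beta_shape.
Qed.

Lemma dot_frob_char_beta (u v : beta_set) : is_beta u -> is_beta v ->
  \sum_(g : {perm 'I_n}) frob_char u g * frob_char v g = n`!%:R * (u == v)%:R.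
Proof.
move=> bu bv; have [pu eu] := is_betaP bu; have [pv ev] := is_betaP bv.
rewrite -[bmnm u]eu -[bmnm v]ev.
rewrite (dot_frob_char pu pv (size_beta_shape _) (size_beta_shape _)); congr (_ * (nat_of_bool _)%:R).
apply/eqP/eqP => [e|-> //]; apply/val_inj => /=.
by rewrite -eu -ev e.
Qed.

Definition in_frob_span (phi : {perm 'I_n} -> int) : Prop :=
  exists c : beta_set -> int, forall g, phi g = \sum_(v | is_beta v) c v * frob_char v g.

Lemma in_frob_span_sum I (r : seq I) (P : pred I) (a : I -> int) F :
  (forall i, P i -> in_frob_span (F i)) ->
  in_frob_span (fun g => \sum_(i <- r | P i) a i * F i g).
Proof.
move=> sF; elim: r => [|i r [c IH]].
  by exists (fun _ => 0) => g; rewrite big_nil big1 // => v _; rewrite mul0r.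
have [Pi|nPi] := boolP (P i); last first.
  by exists c => g; rewrite big_cons (negPf nPi) IH.
have [d dE] := sF i Pi; exists (fun v => a i * d v + c v) => g.
rewrite big_cons Pi IH dE mulr_sumr -big_split /=; apply: eq_bigr => v _.
by rewrite mulrDl mulrA.
Qed.

(** Straightening: sorting the exponent costs a sign, and a repeated entry makes the alternating
    coefficient vanish. *)
Lemma frob_char_in_frob_span (v : 'X_{1..n}) : mdeg v = (n + D)%N ->
  in_frob_span (fun g => frob_char v g).
Proof.
move=> mv.
have [s vs] : exists s : {perm 'I_n}, sort geq v = [tuple tnth v (s i) | i < n].
  by apply/tuple_permP; rewrite perm_sort.
pose u := mperm v s.
have vu g : frob_char v g = (-1) ^+ s * frob_char u g.
  by rewrite /frob_char alternating_frob_char mulrA -signr_addb addbb mul1r.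
have srt : sorted geq u.
  have -> : (u : seq nat) = sort geq v by rewrite vs.
  by apply: sort_sorted => x y /=; apply: leq_total.
have geq_tr : transitive geq by move=> x y z /= h1 h2; apply: leq_trans h2 h1.
have udec (i j : 'I_n) : (i <= j)%N -> (u j <= u i)%N.
  move=> ij; rewrite -!nth_mnm; apply: (sorted_leq_nth geq_tr leqnn 0%N srt) => //;
  by rewrite inE size_tuple.
have [/strict_decP du|ndu] := boolP (strict_decb u); last first.
  exists (fun _ => 0) => g; rewrite [RHS]big1; last by move=> w _; rewrite mul0r.
  rewrite vu.
  move: ndu; rewrite negb_forall => /existsP [i]; rewrite negb_forall => /existsP [j].
  rewrite negb_imply -leqNgt => /andP [ij uij].
  rewrite /frob_char (@alternating_eq0 _ _ u i j) ?mulr0 //; first exact: alternating_frob_char.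
    by apply/eqP => e; rewrite e ltnn in ij.
  by apply/eqP; rewrite eqn_leq uij udec // ltnW.
have mu : mdeg u = (n + D)%N by rewrite mdeg_mperm.
have uD : (mdeg u < (n + D).+1)%N by rewrite mu.
have bu : is_beta (BMultinom uD) by rewrite /is_beta /= mu eqxx andbT; apply/strict_decP.
exists (fun w => (-1) ^+ s * (w == BMultinom uD)%:R) => g.
rewrite (bigD1 (BMultinom uD)) //= eqxx mulr1 -vu big1 ?addr0 // => w /andP [_ /negPf ->].
by rewrite mulr0 mul0r.
Qed.

(** The strict rearrangement inequality for delta, summed from 2xy <= x^2 + y^2, which is strict at
    an index moved by [w]. *)
Lemma dperm_dot_lt (w : {perm 'I_n}) : w != 1%g ->
  (\sum_i dperm w i * (n - 1 - i) < \sum_(i < n) (n - 1 - i) * (n - 1 - i))%N.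
Proof.
move=> w1.
have sq : (\sum_i dperm w i * dperm w i = \sum_(i < n) (n - 1 - i) * (n - 1 - i))%N.
  rewrite [RHS](reindex_inj (@perm_inj _ w)) /=.
  by apply: eq_bigr => i _; rewrite !mnmE.
have [i wi] : exists i, w i != i.
  apply/existsP; apply: contraNT w1 => /existsPn h.
  by apply/eqP/permP => i; rewrite perm1; have := h i; rewrite negbK => /eqP.
suff : (\sum_(i < n) 2 * (dperm w i * (n - 1 - i))
   < \sum_(i < n) (dperm w i * dperm w i + (n - 1 - i) * (n - 1 - i)))%N.
  have -> : (\sum_(i < n) 2 * (dperm w i * (n - 1 - i))
             = 2 * \sum_i dperm w i * (n - 1 - i))%N by rewrite big_distrr.
  by rewrite big_split /= sq addnn -mul2n ltn_pmul2l.
rewrite (bigD1 i) //= [X in (_ < X)%N](bigD1 i) //= -addSn leq_add //.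
  rewrite mnmE; have : nat_of_ord (w i) <> i by move=> e; case/eqP: wi; apply/val_inj.
  have := ltn_ord i; have := ltn_ord (w i).
  set a := nat_of_ord (w i); set b := nat_of_ord i => h1 h2 h3.
  have : ((n - 1 - a) <> (n - 1 - b))%N by lia.
  move: (n - 1 - a)%N (n - 1 - b)%N => x y; nia.
apply: leq_sum => j _.
by have [le _] := nat_Cauchy (dperm w j) (n - 1 - j)%N; rewrite -!mulnn in le.
Qed.

(** Triangularity: in the alternating expansion of the character at beta + delta the identity
    contributes the Young character of [beta]. Every other term belongs to a content with a larger
    scalar product with delta, a quantity bounded by n * n. *)
Lemma young_in_frob_span (beta : 'X_{1..n}) : mdeg beta = n ->
  in_frob_span (fun g => (young_char beta g)%:R).
Proof.
pose f (b : 'X_{1..n}) := (\sum_i b i * (n - 1 - i))%N.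
have [k] := ubnP (n * n - f beta)%N; elim: k beta => // k IH beta ltk mb.
pose v := (beta + dperm 1)%MM.
have mv : mdeg v = (n + D)%N by rewrite mdegD mb mdeg_dperm.
pose ind (w : {perm 'I_n}) := (dperm w <= v)%MM.
have fle (b : 'X_{1..n}) : mdeg b = n -> (f b <= n * n)%N.
  move=> bn; have -> : (n * n = \sum_i b i * n)%N by rewrite -big_distrl /= -mdegE bn.
  apply: leq_sum => i _; rewrite leq_mul2l; apply/orP; right; lia.
have sub_in w : (w != 1%g) && ind w ->
    in_frob_span (fun g => (young_char (v - dperm w)%MM g)%:R).
  case/andP => w1 wv.
  have mw : mdeg (v - dperm w)%MM = n.
    by have := congr1 mdeg (submK wv); rewrite mdegD mv mdeg_dperm => /addIn.
  apply: IH => //.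
  suff : (f beta < f (v - dperm w)%MM)%N by have := fle _ mw; lia.
  have : (f (v - dperm w)%MM + \sum_i dperm w i * (n - 1 - i)
          = f beta + \sum_(i < n) (n - 1 - i) * (n - 1 - i))%N.
    rewrite /f -!big_split /=; apply: eq_bigr => i _.
    rewrite -mulnDl -mnmDE submK // mnmDE mulnDl; congr (_ + _)%N.
    by rewrite mnmE perm1.
  by have := dperm_dot_lt w1; lia.
have [c1 h1] := frob_char_in_frob_span mv.
have [c2 h2] := in_frob_span_sum (index_enum _) (fun w : {perm 'I_n} => (-1) ^+ w) sub_in.
exists (fun u => c1 u - c2 u) => g.
under eq_bigr do rewrite mulrBl.
rewrite sumrB -h1 -h2 frob_charE [in X in X - _](bigD1 1%g) /=; last first.
  by apply/mnm_lepP => i; rewrite mnmDE leq_addl.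
rewrite odd_perm1 expr0 mul1r addmK [in X in _ + X - _](eq_bigl _ _ (fun i => andbC _ _)).
by rewrite addrK.
Qed.

(** A coloring using every colour once is a bijection, fixed by the identity only: this is the
    regular character. *)
Lemma young_ones (g : {perm 'I_n}) :
  young_char ([multinom 1%N | i < n] : 'X_{1..n}) g = (n`! * (g == 1%g))%N.
Proof.
set one := [multinom _ | _ < _].
have fix1 (f : {ffun 'I_n -> 'I_n}) h : content f = one -> colfix f h -> h = 1%g.
  move=> /mnmP f1 /colfixP fh; apply/permP => x; rewrite perm1.
  have := f1 (f x); rewrite !mnmE => /eqP /fintype.card1P [y yP].
  have := yP x; rewrite !inE eqxx => /esym /eqP ->.
  by have := yP (h y); rewrite !inE; have := yP y; rewrite !inE eqxx fh => -> /esym /eqP.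
have [->|g1] := eqVneq g 1%g; last first.
  rewrite muln0; apply: eq_card0 => f; rewrite inE; apply/andP => -[fg /eqP /fix1 h].
  by rewrite (h _ fg) eqxx in g1.
rewrite muln1 -[RHS](@sum_card_stab n _ (fun _ : 'I_n => 1%N)); last by rewrite sum1_card card_ord.
rewrite /young_char -sum1dep_card; apply: eq_big => [f|f /andP [_ /eqP f1]].
  have -> : colfix f 1 by apply/colfixP => x; rewrite perm1.
  apply/eqP/forallP => [/mnmP e c|e]; first by have := e c; rewrite !mnmE => ->.
  by apply/mnmP => c; rewrite !mnmE (eqP (e c)).
rewrite -(cards1 (1%g : {perm 'I_n})); apply: eq_card => h; rewrite !inE.
apply/eqP/idP => [->|]; last exact: fix1.
by apply/colfixP => x; rewrite perm1.
Qed.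

(** The regular character lies in the span, and orthogonality gives its coefficients as the values
    at 1. *)
Lemma frob_char_complete (g : {perm 'I_n}) :
  \sum_(v | is_beta v) frob_char v (1%g : {perm 'I_n}) * frob_char v g = (n`! * (g == 1%g))%:R.
Proof.
have m1 : mdeg ([multinom 1%N | i < n] : 'X_{1..n}) = n.
  by rewrite mdegE; under eq_bigr do rewrite mnmE; rewrite sum1_card card_ord.
have [c cE] := young_in_frob_span m1.
have fn0 : (n`!%:R : int) != 0 by rewrite pnatr_eq0 -lt0n fact_gt0.
rewrite -young_ones cE; apply: eq_bigr => u bu; congr (_ * _).
have : \sum_(h : {perm 'I_n}) (young_char ([multinom 1%N | i < n] : 'X_{1..n}) h)%:R * frob_char u h
   = n`!%:R * c u.
  under eq_bigr do rewrite cE mulr_suml.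
  rewrite exchange_big /= (bigD1 u) //= [X in _ + X]big1; last first.
    move=> v /andP [bv /negPf vu]; under eq_bigr do rewrite -mulrA.
    by rewrite -mulr_sumr dot_frob_char_beta // vu !mulr0.
  under eq_bigr do rewrite -mulrA.
  by rewrite -mulr_sumr dot_frob_char_beta // eqxx mulr1 addr0 mulrC.
rewrite (bigD1 1%g) //= young_ones eqxx muln1 big1 ?addr0 => [|h /negPf h1].
  by move/(mulfI fn0).
by rewrite young_ones h1 muln0 mul0r.
Qed.

End Completeness.

(** * Extending permutations of a subset by fixed points *)

Section Extension.
Variables (k n : nat) (j : 'I_k -> 'I_n).
Hypothesis inj_j : injective j.
Implicit Types (s t : {perm 'I_k}).

Definition ext_fun s (y : 'I_n) : 'I_n := if [pick x | j x == y] is Some x then j (s x) else y.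

Lemma ext_fun_in s x : ext_fun s (j x) = j (s x).
Proof. by rewrite /ext_fun; case: pickP => [x' /eqP /inj_j -> //|/(_ x)]; rewrite eqxx. Qed.

Lemma ext_fun_out s y : y \notin codom j -> ext_fun s y = y.
Proof.
by move=> yj; rewrite /ext_fun; case: pickP => // x /eqP xy; rewrite -xy codom_f in yj.
Qed.

Lemma ext_funM s t y : ext_fun t (ext_fun s y) = ext_fun (s * t) y.
Proof.
have [/codomP [x ->]|yj] := boolP (y \in codom j); first by rewrite !ext_fun_in permM.
by rewrite !ext_fun_out.
Qed.

Lemma ext_fun1 y : ext_fun 1 y = y.
Proof.
have [/codomP [x ->]|yj] := boolP (y \in codom j); first by rewrite ext_fun_in perm1.
by rewrite ext_fun_out.
Qed.

Lemma ext_fun_inj s : injective (ext_fun s).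
Proof.
by apply: (can_inj (g := ext_fun s^-1)) => y; rewrite ext_funM mulgV ext_fun1.
Qed.

Definition ext s : {perm 'I_n} := perm (@ext_fun_inj s).

Lemma ext_in s x : ext s (j x) = j (s x).
Proof. by rewrite permE ext_fun_in. Qed.

Lemma ext_out s y : y \notin codom j -> ext s y = y.
Proof. by move=> yj; rewrite permE ext_fun_out. Qed.

Lemma extM s t : ext (s * t) = (ext s * ext t)%g.
Proof. by apply/permP => y; rewrite permM !permE ext_funM. Qed.

Lemma ext1 : ext 1 = 1%g.
Proof. by apply/permP => y; rewrite permE ext_fun1 perm1. Qed.

Lemma extV s : ext s^-1 = (ext s)^-1%g.
Proof. by apply/esym/eqP; rewrite eq_invg_mul -extM mulgV ext1. Qed.

Lemma extX s i : ext (s ^+ i) = (ext s ^+ i)%g.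
Proof. by elim: i => [|i IH]; rewrite ?ext1 // !expgS extM IH. Qed.

Lemma porbit_ext_in s x : porbit (ext s) (j x) = j @: porbit s x.
Proof.
apply/setP => y; apply/porbitP/imsetP => [[i ->]|[x' /porbitP [i ->] ->]].
  by exists ((s ^+ i)%g x); rewrite ?mem_porbit // -extX ext_in.
by exists i; rewrite -extX ext_in.
Qed.

Lemma porbit_ext_out s y : y \notin codom j -> porbit (ext s) y = [set y].
Proof.
move=> yj; apply/setP => z; rewrite inE; apply/porbitP/eqP => [[i ->]|->].
  by rewrite -extX ext_out.
by exists 0; rewrite expg0 perm1.
Qed.

Lemma prod_porbits_ext (R : comPzRingType) (F : nat -> R) s :
  \prod_(c in porbits (ext s)) F #|c|
    = F 1%N ^+ (n - k) * \prod_(c in porbits s) F #|c|.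
Proof.
pose im := [set j x | x in 'I_k].
have im_codom y : (y \in im) = (y \in codom j).
  by apply/imsetP/codomP => [[x _ ->]|[x ->]]; exists x.
rewrite (bigID (fun c : {set 'I_n} => c \subset im)) /= mulrC; congr (_ * _).
  rewrite (eq_bigl (mem [set [set y] | y in ~: im])); last first.
    move=> c /=; apply/andP/imsetP => [[/imsetP [y _ ->]]|[y yim ->]].
      have [/codomP [x ->]|yj] := boolP (y \in codom j); last first.
        by rewrite porbit_ext_out // => _; exists y; rewrite // inE im_codom.
      rewrite porbit_ext_in => /negP []; apply/subsetP => z /imsetP [x' _ ->].
      by rewrite im_codom codom_f.
    rewrite inE im_codom in yim; split; last by rewrite sub1set im_codom.
    by rewrite -(porbit_ext_out s yim); apply: imset_f.
  rewrite big_imset /=; last by move=> x y _ _; apply: set1_inj.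
  under eq_bigr do rewrite cards1.
  rewrite prodr_const; congr (_ ^+ _).
  by rewrite -[n in RHS]card_ord -(cardsC im) card_imset // card_ord addKn.
rewrite (eq_bigl (mem [set j @: c | c : {set 'I_k} in porbits s])); last first.
  move=> c /=; apply/andP/imsetP => [[/imsetP [y _ ->] sub]|[c' /imsetP [x _ ->] ->]].
    have : y \in im by apply: (subsetP sub); apply: porbit_id.
    rewrite im_codom => /codomP [x ->]; exists (porbit s x); rewrite ?porbit_ext_in //.
    exact: imset_f.
  split; first by rewrite -porbit_ext_in; apply: imset_f.
  by apply: imsetS; apply/subsetP.
rewrite big_imset /=; last by move=> c c' _ _; apply: imset_inj.
by apply: eq_bigr => c _; rewrite card_imset.
Qed.

Lemma cycle_poly_ext N s :
  cycle_poly N (ext s) = power_sum N 1 ^+ (n - k) * cycle_poly N s.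
Proof. by rewrite -!prod_power_sum (prod_porbits_ext (power_sum N)). Qed.

End Extension.

(** * The branching rule *)

Section Branching.
Variables (k N : nat) (mu : seq nat).
Hypotheses (pm : is_partition k mu) (kN : (k <= N)%N).

Lemma power_sum1E : power_sum N 1 = \sum_(i < N) 'X_[U_(i)].
Proof. by []. Qed.

Lemma symmetric_power_sum1 : symmetric_poly (power_sum N 1).
Proof.
move=> m s; rewrite power_sum1E !raddf_sum /= [RHS](reindex_inj (@perm_inj _ s)) /=.
apply: eq_bigr => i _; rewrite !mcoeffX; congr (nat_of_bool _)%:R.
apply/eqP/eqP => [/mnmP e|<-]; apply/mnmP => a.
  have := e (s^-1 a)%g; rewrite mnm1E mnmE permKV mnm1E => <-.
  by rewrite -(inj_eq (@perm_inj _ s) i) permKV.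
by rewrite !mnmE (inj_eq perm_inj).
Qed.

Let Q e (g : {perm 'I_k}) := vandermonde N * (power_sum N 1 ^+ e * cycle_poly N g).

(** For v = lambda + delta with |lambda| = k + e, this is k! times the inner product of chi_mu with
    the restriction of chi_lambda to S_k: each of the e fixed points contributes a factor p_1. *)
Definition branching_sum e (v : 'X_{1..N}) : int :=
  \sum_(g : {perm 'I_k}) (Q e g)@_v * frob_char (frob_exp k mu) g.

Lemma alternating_Q e g : alternating (Q e g).
Proof.
apply: alternatingM; first exact: alternating_vandermonde.
apply: symmetricM; last exact: symmetric_cycle_poly.
elim: e => [|e IH]; first exact: symmetric1.
by rewrite exprS; apply: symmetricM; first exact: symmetric_power_sum1.
Qed.

(** Multiplying by p_1 sums over the removal of one box. If the result is no longer strictly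
    decreasing, it has two equal entries and its alternating coefficient vanishes. *)
Lemma branching_sumS e v : strict_dec v -> branching_sum e.+1 v =
  \sum_(i | (0 < v i)%N && strict_decb (v - U_(i))%MM) branching_sum e (v - U_(i))%MM.
Proof.
move=> dv; rewrite /branching_sum exchange_big /=; apply: eq_bigr => g _.
rewrite -mulr_suml; congr (_ * _).
have -> : Q e.+1 g = power_sum N 1 * Q e g by rewrite /Q exprS -mulrA mulrCA.
rewrite power_sum1E mulr_suml raddf_sum /= [RHS]big_mkcond; apply: eq_bigr => i _.
rewrite mcoeffXM.
have -> : (U_(i) <= v)%MM = (0 < v i)%N.
  apply/mnm_lepP/idP => [/(_ i)|vi a]; rewrite mnm1E; first by rewrite eqxx.
  by case: eqP => // <-.
case: ltnP => //= vi; case: ifPn => //.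
rewrite negb_forall => /existsP [a]; rewrite negb_forall => /existsP [b].
rewrite negb_imply -leqNgt => /andP [ab le].
apply: (@alternating_eq0 _ _ _ a b); first exact: alternating_Q.
  by apply/eqP => e'; rewrite e' ltnn in ab.
have := dv _ _ ab; move: le; rewrite !mnmBE !mnm1E.
by case: eqP => [<-|_]; case: eqP => [<-|_]; lia.
Qed.

(** All terms of the recursion are nonnegative, so nothing cancels: the sum is nonzero as soon as
    one box can be removed with [mu] still contained in the rest. At e = 0 the sizes agree and
    containment is equality. *)
Lemma branching_sumP e (v : 'X_{1..N}) : strict_dec v ->
  mdeg v = (k + e + \sum_(0 <= i < N) (N - 1 - i))%N ->
  0 <= branching_sum e v /\
  (branching_sum e v != 0 <-> forall i, (nth 0 mu i <= vpart v i)%N).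
Proof.
have smN : (size mu <= N)%N := leq_trans (is_partition_size pm) kN.
elim: e v => [|e IH] v dv mv.
  rewrite addn0 in mv; have pv := beta_shape_partition dv mv.
  have -> : branching_sum 0 v = k`!%:R * (beta_shape v == mu)%:R.
    rewrite -(dot_frob_char pv pm (size_beta_shape v) (is_partition_size pm)) (frob_beta_shape dv).
    by apply: eq_bigr => g _; rewrite /Q expr0 mul1r.
  split; first by rewrite -natrM ler0n.
  rewrite mulf_eq0 negb_or pnatr_eq0 -lt0n fact_gt0 /= pnatr_eq0 eqb0 negbK.
  split=> [/eqP <- i|le]; first by rewrite nth_beta_shape.
  apply/eqP; apply: (is_partition_eq pv pm) => i; rewrite nth_beta_shape //.
  apply/eqP; rewrite eqn_leq le andbT leqNgt; apply/negP => lt.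
  have iN : (i < N)%N.
    by rewrite ltnNge; apply/negP => Ni; rewrite /vpart nth_mnm_default in lt.
  have s1 := is_partition_sum pm smN.
  have s2 := is_partition_sum pv (size_beta_shape v).
  have : (\sum_(0 <= i < N) nth 0 mu i < \sum_(0 <= i < N) nth 0 (beta_shape v) i)%N.
    rewrite (bigD1_seq i) ?iota_uniq ?mem_index_iota //=.
    rewrite [X in (_ < X)%N](bigD1_seq i) ?iota_uniq ?mem_index_iota //=.
    rewrite -addSn leq_add ?nth_beta_shape //; apply: leq_sum => a _.
    by rewrite nth_beta_shape.
  by rewrite s1 s2 ltnn.
rewrite branching_sumS //.
have IHi i : (0 < v i)%N && strict_decb (v - U_(i))%MM ->
   0 <= branching_sum e (v - U_(i))%MM /\
   (branching_sum e (v - U_(i))%MM != 0 <->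
    forall a, (nth 0 mu a <= vpart (v - U_(i))%MM a)%N).
  case/andP => vi /strict_decP dvi; apply: IH => //.
  have Uv : (U_(i) <= v)%MM by apply/mnm_lepP => a; rewrite mnm1E; case: eqP => // <-.
  by have := congr1 mdeg (submK Uv); rewrite mdegD mdeg1 mv; lia.
split; first by apply: sumr_ge0 => i /IHi [].
rewrite psumr_neq0; last by move=> i /IHi [].
split=> [/hasP [i _ /andP [Pi]]|le].
  rewrite lt0r => /andP [nz _] a; apply: leq_trans (_ : vpart (v - U_(i))%MM a <= _)%N.
    by apply: (proj1 (proj2 (IHi i Pi))).
  by apply: vpart_le; apply/mnm_lepP => b; rewrite mnmBE leq_subr.
have [i0 lt0] : exists i : 'I_N, (nth 0 mu i < vpart v i)%N.
  apply/existsP; apply: contraT => /existsPn h.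
  have : (\sum_(0 <= i < N) vpart v i <= \sum_(0 <= i < N) nth 0 mu i)%N.
    rewrite !big_mkord; apply: leq_sum => i _.
    by have := h i; rewrite -leqNgt.
  rewrite (is_partition_sum pm smN).
  by have := mdeg_vpart dv; rewrite mv; lia.
(* The last row longer than in [mu] has a removable box: the next row is at most mu_(i+1) <= mu_i,
   which is below row [i]. *)
pose i := [arg max_(i > i0 | (nth 0 mu i < vpart v i)%N) nat_of_ord i].
have [lti imax] : (nth 0 mu i < vpart v i)%N /\
    forall a : 'I_N, (nth 0 mu a < vpart v a)%N -> (a <= i)%N.
  by rewrite /i; case: arg_maxnP.
have vi : (0 < v i)%N by rewrite -nth_mnm; move: lti; rewrite /vpart; lia.
have dvi : strict_dec (v - U_(i))%MM.
  move=> a b ab; rewrite !mnmBE !mnm1E.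
  have vab := dv _ _ ab.
  case: (i =P a) => [e1|_]; last by case: eqP => [_|_]; lia.
  case: (i =P b) => [e2|_]; first by rewrite -e1 e2 ltnn in ab.
  subst a.
  have [e1|ne] := eqVneq (i.+1) b; last first.
    have ltb : (i.+1 < b)%N by rewrite ltn_neqAle ne.
    have i1N := ltn_trans ltb (ltn_ord b).
    have := dv (Ordinal i1N) b ltb; have := dv i (Ordinal i1N) (ltnSn i); lia.
  have leb : (vpart v b <= nth 0 mu b)%N by rewrite leqNgt; apply/negP => /imax; rewrite -e1 ltnn.
  have := is_partition_dec pm (leqnSn i).
  have := strict_dec_ge dv (ltn_ord b).
  move: lti leb; rewrite /vpart !nth_mnm.
  have := ltn_ord b; rewrite -e1; lia.
apply/hasP; exists i; first by rewrite mem_index_enum.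
have Pi : (0 < v i)%N && strict_decb (v - U_(i))%MM by rewrite vi; apply/strict_decP.
rewrite Pi lt0r (proj1 (IHi i Pi)) andbT.
apply/(proj2 (IHi i Pi)) => a.
have [aN|Na] := ltnP a N; last by rewrite nth_default // (leq_trans smN).
have := le a; rewrite /vpart -[a in nth 0 v a]/(nat_of_ord (Ordinal aN)).
rewrite -[a in nth 0 (v - _)%MM a]/(nat_of_ord (Ordinal aN)) !nth_mnm mnmBE mnm1E.
case: eqP => [e1|_]; last by rewrite subn0.
move: lti; rewrite /vpart nth_mnm e1 /=; lia.
Qed.

End Branching.

Lemma Schar_branching k n (j : 'I_k -> 'I_n) (inj_j : injective j) lam mu :
  is_partition n lam -> is_partition k mu ->
  (\sum_(s : {perm 'I_k}) Schar lam (ext inj_j s) * Schar mu s != 0) <->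
  (forall i, nth 0 mu i <= nth 0 lam i)%N.
Proof.
move=> pl pm.
have kn : (k <= n)%N by have := leq_card j inj_j; rewrite !card_ord.
have sl := is_partition_size pl.
have -> : \sum_(s : {perm 'I_k}) Schar lam (ext inj_j s) * Schar mu s
   = branching_sum k mu (n - k) (frob_exp n lam).
  apply: eq_bigr => s _; rewrite !ScharE; congr (_ * _).
  by rewrite /frob_char cycle_poly_ext.
have [||_ H] := @branching_sumP k n mu pm kn (n - k) (frob_exp n lam).
- exact: frob_strict pl.
- by rewrite subnKC // (mdeg_frob pl sl).
by apply: iff_trans H _; split=> h i; have := h i; rewrite (vpart_frob _ pl sl).
Qed.

(** * Irreducibility *)

Section Irreducible.
Variable n : nat.
Let G := [set: {perm 'I_n}]%G.

(** This is the trivial character induced from the stabilizer of one coloring of content [beta];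
    without such a coloring the value is 0. *)
Lemma young_char_character N (beta : 'X_{1..N}) :
  exists2 phi : 'CF(G), phi \is a character & forall g, phi g = (young_char beta g)%:R.
Proof.
have [bn|nbn] := eqVneq (mdeg beta) n; last first.
  exists 0; first exact: rpred0.
  move=> g; rewrite cfunE; apply/esym/eqP; rewrite pnatr_eq0 cards_eq0.
  apply/eqP/setP => f; rewrite !inE; apply/negP => /andP [_ /eqP fb].
  by rewrite -fb mdeg_content eqxx in nbn.
have [f0 f0b] : exists f : {ffun 'I_n -> 'I_N}, content f = beta.
  have [f fb] := @exists_coloring n _ (fun i => beta i) (etrans (esym (mdegE _)) bn).
  by exists f; apply/mnmP => i; rewrite mnmE fb.
pose H := [set g | colfix f0 g].
have gH : group_set H.
  apply/group_setP; split=> [|g h].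
    by rewrite inE; apply/colfixP => x; rewrite perm1.
  rewrite !inE => /colfixP fg /colfixP fh; apply/colfixP => x.
  by rewrite permM fh fg.
pose K := Group gH.
have HE g : (g \in K) = colfix f0 g by rewrite [LHS]inE.
exists ('Ind[G] (1 : 'CF(K))); first by rewrite cfInd_char // rpred1.
move=> g; rewrite cfIndE ?subsetT //.
under eq_bigr do rewrite cfun1E.
rewrite -natr_sum.
suff -> : (\sum_(y in G) ((g ^ y)%g \in K) = young_char beta g * #|H|)%N.
  by rewrite natrM mulrC mulfK // pnatr_eq0 -lt0n (cardG_gt0 K).
have conjE y : ((g ^ y)%g \in K) = colfix [ffun x => f0 (y x)] g.
  rewrite HE; apply/colfixP/colfixP => fg x.
    by have := fg (y x); rewrite !ffunE conjgE !permM permK.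
  by have := fg (y^-1 x)%g; rewrite !ffunE conjgE !permM permKV.
transitivity (\sum_(f : {ffun 'I_n -> 'I_N} | colfix f g && (content f == beta)) #|H|)%N;
  last by rewrite sum_nat_cond_const; congr (_ * _)%N; apply: eq_card => f; rewrite !inE.
rewrite (eq_bigr (fun y : {perm 'I_n} => if colfix [ffun x => f0 (y x)] g then 1 else 0)%N);
  last by move=> y _; rewrite conjE; case: ifP.
rewrite -big_mkcondr (partition_big (fun y : {perm 'I_n} => [ffun x => f0 (y x)])
  (fun f => colfix f g && (content f == beta))) /=; last first.
  move=> y /andP [_ ->] /=; rewrite -f0b; apply/eqP/mnmP => i.
  by rewrite !mnmE col_count_perm.
apply: eq_bigr => f /andP [fg /eqP fb].
have [h0 fE] : exists h : {perm 'I_n}, f = [ffun x => f0 (h x)].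
  apply: col_count_transitive => i.
  have cE : content f0 = content f by rewrite fb.
  by have := congr1 (fun m : 'X_{1..N} => m i) cE; rewrite !mnmE.
rewrite -(card_translates f0 h0) -fE sum1dep_card; apply: eq_card => y.
by rewrite !inE; case: eqP => [->|]; rewrite ?fg ?andbF.
Qed.

Lemma frob_char_vchar N (v : 'X_{1..N}) :
  exists2 phi : 'CF(G), phi \in 'Z[irr G]%g & forall g, phi g = (frob_char v g)%:~R.
Proof.
have [c cC cE] := fin_all_exists2 (fun w : {perm 'I_N} =>
  young_char_character (v - dperm w)%MM).
exists (\sum_(w : {perm 'I_N} | (dperm w <= v)%MM) (-1) ^+ w *: c w).
  by apply: rpred_sum => w _; rewrite rpredZsign; apply: char_vchar.
move=> g; rewrite sum_cfunE frob_charE rmorph_sum /=; apply: eq_bigr => w _.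
by rewrite cfunE cE rmorphM /= rmorph_sign rmorph_nat.
Qed.

Variables (lam : seq nat).
Hypothesis pl : is_partition n lam.

Lemma Schar_norm : \sum_(g : {perm 'I_n}) Schar lam g * Schar lam g = n`!%:R.
Proof.
under eq_bigr do rewrite ScharE.
by rewrite (dot_frob_char pl pl) ?is_partition_size // eqxx mulr1.
Qed.

Lemma Schar_irr : exists (b : bool) (i : Iirr G),
  forall g, (Schar lam g)%:~R = (-1) ^+ b * 'chi_i g.
Proof.
have [phi phiZ phiE] := frob_char_vchar (frob_exp n lam).
have nphi : '[phi] = 1.
  rewrite cfdotE (eq_bigl predT) => [|g]; last by rewrite inE.
  under eq_bigr do rewrite phiE rmorph_int -rmorphM /= -!ScharE.
  rewrite -rmorph_sum Schar_norm /= cardsT card_Sn rmorph_nat mulVf //.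
  by rewrite pnatr_eq0 -lt0n fact_gt0.
have [b [i e]] := vchar_norm1P phiZ nphi.
by exists b, i => g; rewrite ScharE -phiE e cfunE.
Qed.

Lemma Schar1_neq0 : Schar lam (1%g : {perm 'I_n}) != 0.
Proof.
have [b [i e]] := Schar_irr.
rewrite -(intr_eq0 algC) e mulf_eq0 negb_or irr1_neq0 andbT.
by rewrite expf_eq0 oppr_eq0 oner_eq0 andbF.
Qed.

Lemma ScharV (g : {perm 'I_n}) : Schar lam g^-1 = Schar lam g.
Proof. by rewrite !ScharE frob_charV. Qed.

Lemma ScharJ (g h : {perm 'I_n}) : Schar lam (g ^ h)%g = Schar lam g.
Proof. by rewrite !ScharE frob_charJ. Qed.

Lemma ScharC (g h : {perm 'I_n}) : Schar lam (g * h)%g = Schar lam (h * g)%g.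
Proof. by rewrite -[in RHS](ScharJ _ h) conjgE mulgA mulKg. Qed.

(** Schur's lemma: a class function acts on an irreducible representation by a scalar. Multiplying
    by the degree keeps the identity in the integers, and the unknown sign cancels because both
    sides are quadratic in [Schar]. *)
Lemma Schar_conv (u : {perm 'I_n} -> int) (x : {perm 'I_n}) :
  (forall g h, u (g ^ h)%g = u g) ->
  Schar lam (1%g : {perm 'I_n}) * \sum_h Schar lam (x * h^-1)%g * u h
    = (\sum_h Schar lam h * u h) * Schar lam x.
Proof.
move=> uJ.
have ucf : is_class_fun <<G>>%g [ffun g => (u g)%:~R : algC].
  rewrite genGid; apply: intro_class_fun => [g h _ _|g]; first by rewrite uJ.
  by rewrite inE.
pose U : 'CF(G) := Cfun 0 ucf.
have UE g : U g = (u g)%:~R by rewrite cfunElock.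
have [b [i e]] := Schar_irr.
have n0 : (n`!%:R : algC) != 0 by rewrite pnatr_eq0 -lt0n fact_gt0.
have cG : #|G| = n`! by rewrite cardsT card_Sn.
have dotU : '[U, 'chi_i] * n`!%:R * (-1) ^+ b = (\sum_h Schar lam h * u h)%:~R.
  rewrite cfdotE cG [_^-1 * _]mulrC mulfVK // rmorph_sum /= mulr_suml.
  apply: eq_big => [g|g _]; first by rewrite inE.
  have chiE : 'chi_i g = (-1) ^+ b * (Schar lam g)%:~R by rewrite e mulrA -expr2 sqrr_sign mul1r.
  rewrite UE chiE rmorphM rmorph_sign rmorph_int rmorphM /=.
  set s := (-1) ^+ b; have ss : s * s = 1 by rewrite -expr2 sqrr_sign.
  transitivity ((s * s) * ((Schar lam g)%:~R * (u g)%:~R)); first by ring.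
  by rewrite ss mul1r.
have conv : \sum_h (Schar lam (x * h^-1)%g)%:~R * (u h)%:~R
   = (-1) ^+ b * ('[U, 'chi_i] * n`!%:R * ('chi_i x / 'chi_i 1%g)).
  transitivity ((-1) ^+ b * \sum_(z in G) 'chi_i (z * x)%g * U z^-1%g).
    rewrite mulr_sumr (reindex_inj invg_inj) /=.
    apply: eq_big => [z|z _]; first by rewrite inE.
    by rewrite invgK UE mulrA ScharC e.
  congr (_ * _).
  under eq_bigr do rewrite {1}[U]cfun_sum_cfdot sum_cfunE mulr_sumr.
  rewrite exchange_big /= (bigD1 i) //= [X in _ + X]big1 ?addr0; last first.
    move=> j /negPf ij; have := generalized_orthogonality_relation x i j.
    rewrite eq_sym ij mul0r cG => /eqP; rewrite mulf_eq0 invr_eq0 (negPf n0) /=.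
    move=> /eqP s0; rewrite -[RHS](mulr0 '[U, 'chi_j]) -[X in _ = _ * X]s0 mulr_sumr.
    by apply: eq_bigr => z _; rewrite cfunE mulrCA.
  rewrite -mulrA; have := generalized_orthogonality_relation x i i.
  rewrite eqxx mul1r cG => <-; rewrite mulVKf // mulr_sumr.
  by apply: eq_bigr => z _; rewrite cfunE mulrCA.
apply: (@intr_inj algC); rewrite !rmorphM /= -dotU rmorph_sum /=.
under eq_bigr do rewrite rmorphM /=.
rewrite conv !e; have chi1 := irr1_neq0 i.
set s := (-1) ^+ b; have ss : s * s = 1 by rewrite -expr2 sqrr_sign.
set d := '[U, 'chi_i] * _.
transitivity ((s * s) * d * ('chi_i x * ('chi_i 1%g / 'chi_i 1%g))).
  by ring.
by rewrite divff // mulr1; ring.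
Qed.

Lemma Schar_conv_self (r : {perm 'I_n}) :
  Schar lam (1%g : {perm 'I_n}) * \sum_h Schar lam (r * h)%g * Schar lam h
    = n`!%:R * Schar lam r.
Proof.
have := @Schar_conv (fun g => Schar lam g) r ScharJ.
rewrite Schar_norm => <-; congr (_ * _).
rewrite [RHS](reindex_inj invg_inj) /=; apply: eq_bigr => h _.
by rewrite invgK ScharV.
Qed.

End Irreducible.

(** Up to the nonzero factors [Schar lam 1] and [Schar mu 1], the sum over [x] of the squares of
    these integers is n! k! times the branching number; if that is 0, each of them is. *)
Lemma Schar_restr_eq0 k n (j : 'I_k -> 'I_n) (inj_j : injective j) lam mu :
  is_partition n lam -> is_partition k mu ->
  \sum_(s : {perm 'I_k}) Schar lam (ext inj_j s) * Schar mu s = 0 ->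
  forall x : {perm 'I_n},
    \sum_(s : {perm 'I_k}) Schar lam (x * (ext inj_j s)^-1)%g * Schar mu s = 0.
Proof.
move=> pl pm s0.
pose T (x : {perm 'I_n}) :=
  \sum_(s : {perm 'I_k}) Schar lam (x * (ext inj_j s)^-1)%g * Schar mu s.
suff T2 : \sum_x T x ^+ 2 = 0.
  move=> x; apply/eqP; rewrite -sqrf_eq0.
  have /eqP := T2; rewrite psumr_eq0 => [/allP /(_ x (mem_index_enum _)) //|y _].
  exact: sqr_ge0.
apply: (mulfI (Schar1_neq0 pl)); apply: (mulfI (Schar1_neq0 pm)); rewrite !mulr0.
transitivity (n`!%:R * (k`!%:R * \sum_(s : {perm 'I_k}) Schar lam (ext inj_j s) * Schar mu s));
  last by rewrite s0 !mulr0.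
have inner (s s' : {perm 'I_k}) : Schar lam (1%g : {perm 'I_n}) *
    \sum_(x : {perm 'I_n}) Schar lam (x * (ext inj_j s)^-1)%g * Schar lam (x * (ext inj_j s')^-1)%g
     = n`!%:R * Schar lam (ext inj_j (s * s'^-1)%g).
  rewrite -(Schar_conv_self pl); congr (_ * _).
  rewrite (reindex_inj (mulIg (ext inj_j s))) /=; apply: eq_bigr => y _.
  by rewrite mulgK mulrC extM extV [in RHS]ScharC mulgA.
have -> : Schar lam (1%g : {perm 'I_n}) * \sum_x T x ^+ 2 =
    n`!%:R * \sum_(r : {perm 'I_k}) Schar lam (ext inj_j r) *
      \sum_(s' : {perm 'I_k}) Schar mu (r * s')%g * Schar mu s'.
  transitivity (\sum_(s : {perm 'I_k}) \sum_(s' : {perm 'I_k})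
     Schar mu s * Schar mu s' * (n`!%:R * Schar lam (ext inj_j (s * s'^-1)%g))).
    have -> : \sum_x T x ^+ 2 = \sum_(s : {perm 'I_k}) \sum_(s' : {perm 'I_k})
      Schar mu s * Schar mu s' * \sum_(x : {perm 'I_n})
       Schar lam (x * (ext inj_j s)^-1)%g * Schar lam (x * (ext inj_j s')^-1)%g.
      transitivity (\sum_(x : {perm 'I_n}) \sum_(s : {perm 'I_k}) \sum_(s' : {perm 'I_k})
        Schar mu s * Schar mu s' *
        (Schar lam (x * (ext inj_j s)^-1)%g * Schar lam (x * (ext inj_j s')^-1)%g)).
        apply: eq_bigr => x _; rewrite expr2 mulr_suml; apply: eq_bigr => s _.
        rewrite mulr_sumr; apply: eq_bigr => s' _.
        by rewrite [LHS]mulrACA mulrC.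
      rewrite exchange_big /=; apply: eq_bigr => s _; rewrite exchange_big /=.
      by apply: eq_bigr => s' _; rewrite mulr_sumr.
    rewrite mulr_sumr; apply: eq_bigr => s _; rewrite mulr_sumr; apply: eq_bigr => s' _.
    by rewrite mulrCA inner.
  rewrite mulr_sumr exchange_big /=.
  under eq_bigr => s' _ do rewrite (reindex_inj (mulIg s')) /=.
  rewrite exchange_big /=; apply: eq_bigr => r _; rewrite mulr_sumr mulr_sumr.
  by apply: eq_bigr => s' _; rewrite mulgK mulrCA; congr (_ * _); rewrite mulrC.
rewrite mulrCA; congr (_ * _); rewrite !mulr_sumr; apply: eq_bigr => r _.
by rewrite mulrCA (Schar_conv_self pm) mulrCA.
Qed.

(* Averaging the S_k-element over conjugation gives a central element on which
   the branching multiplicity is read off. *)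
Lemma Schar_conv_avg k n (j : 'I_k -> 'I_n) (inj_j : injective j) lam mu :
  is_partition n lam -> forall x : {perm 'I_n},
  Schar lam (1%g : {perm 'I_n}) *
    (\sum_(h : {perm 'I_n}) \sum_(s : {perm 'I_k})
       Schar lam (x * ((ext inj_j s) ^ h)^-1)%g * Schar mu s)
  = n`!%:R * (\sum_(s : {perm 'I_k}) Schar lam (ext inj_j s) * Schar mu s) * Schar lam x.
Proof.
move=> pl x.
pose u (g : {perm 'I_n}) : int :=
  \sum_(h : {perm 'I_n}) \sum_(s : {perm 'I_k} | g == (ext inj_j s ^ h)%g) Schar mu s.
have uJ g h : u (g ^ h)%g = u g.
  rewrite /u (reindex_inj (mulIg h)) /=; apply: eq_bigr => h' _.
  by apply: eq_bigl => s; rewrite conjgM (inj_eq (@conjg_inj _ h)).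
have sumu (F : {perm 'I_n} -> int) : \sum_g F g * u g =
    \sum_(h : {perm 'I_n}) \sum_(s : {perm 'I_k}) F (ext inj_j s ^ h)%g * Schar mu s.
  under eq_bigr do rewrite mulr_sumr.
  rewrite exchange_big /=; apply: eq_bigr => h _.
  under eq_bigr do rewrite mulr_sumr.
  rewrite (exchange_big_dep predT) //=; apply: eq_bigr => s _.
  by rewrite big_pred1_eq.
rewrite -(sumu (fun g => Schar lam (x * g^-1)%g)) (Schar_conv pl x uJ); congr (_ * _).
rewrite (sumu (fun g => Schar lam g)).
under eq_bigr => h _ do under eq_bigr => s _ do rewrite ScharJ.
by rewrite sumr_const card_Sn mulr_natl.
Qed.

(** * The cocharacter and isotypic components *)

Lemma bigA_distr_dffun (R : pzSemiRingType) (I : finType) (T_ : I -> finType)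
    (F : forall i, T_ i -> R) :
  \prod_i \sum_(x : T_ i) F i x
    = \sum_(f : {dffun forall i, T_ i}) \prod_i F i (f i).
Proof.
pose P_ i := [ffun x : T_ i => F i x].
transitivity (\prod_i \sum_(x : T_ i) P_ i x).
  by apply: eq_bigr => i _; apply: eq_bigr => x _; rewrite ffunE.
rewrite (reindex (@dffun_of_fprod _ T_)) /=; last exact/onW_bij/dffun_of_fprod_bij.
transitivity (\sum_(t : fprod T_) \prod_(i in I) P_ i (t i)); last first.
  by apply: eq_bigr => t _; apply: eq_bigr => i _; rewrite !ffunE.
transitivity (\prod_i \sum_(j in tagged_with T_ i) untag 0 (P_ i) j).
  by apply: eq_bigr => i _; apply: (big_tag (fun i x => P_ i x)).
rewrite bigA_distr_big_dep; apply/esym.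
exact: (@big_fprod _ _ _ _ _ I T_ P_).
Qed.

(** * Traces of idempotents and invariant subspaces *)

Section LinearAlgebra.
Variables (F : fieldType) (m : nat).
Hypothesis charF0 : [pchar F] =i pred0.

Lemma char0_natr_eq0 k : (k%:R == 0 :> F) = (k == 0)%N.
Proof. exact: (pcharf0P F).1 charF0 k. Qed.

Lemma char0_intr_eq0 (z : int) : (z%:~R == 0 :> F) = (z == 0).
Proof.
case: z => k; first by rewrite -pmulrn char0_natr_eq0.
by rewrite NegzE mulrNz -pmulrn oppr_eq0 char0_natr_eq0.
Qed.

(** A vector of [P] outside the row space raises the rank, which is at most [m]; whether such a
    vector exists is decided classically. *)
Lemma exists_span_matrix (P : 'rV[F]_m -> Prop) : P 0 ->
  (forall (a : F) x y, P x -> P y -> P (a *: x + y)) ->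
  exists U : 'M[F]_m, forall f : 'rV_m, (f <= U)%MS <-> P f.
Proof.
move=> P0 Plin.
have step k (U : 'M[F]_m) : (m - \rank U < k)%N -> (forall f : 'rV_m, (f <= U)%MS -> P f) ->
    exists U : 'M[F]_m, forall f : 'rV_m, (f <= U)%MS <-> P f.
  elim: k U => // k IH U rk UP.
  have [[f [Pf nfU]]|no] := classic (exists f : 'rV_m, P f /\ ~~ (f <= U)%MS); last first.
    exists U => f; split; first exact: UP.
    by move=> Pf; apply: contraT => nf; case: no; exists f.
  have lt : (U < U + f)%MS.
    by rewrite ltmxE addsmxSl /=; apply: contra nfU; apply: submx_trans (addsmxSr _ _).
  apply: (IH (U + f)%MS).
    by have := rank_ltmx lt; have := rank_leq_row (U + f)%MS; lia.
  move=> h /sub_addsmxP [[u v] /= ->].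
  rewrite (mx11_scalar v) mul_scalar_mx addrC; apply: Plin => //.
  by apply: UP; apply: submxMl.
apply: (step (m.+1) 0); first by rewrite mxrank0; lia.
by move=> f; rewrite submx0 => /eqP ->.
Qed.

(** In a rank factorization E = C R, idempotence gives R C = 1, and tr (C R) = tr (R C). *)
Lemma mxtrace_idempotent k (E : 'M[F]_k) : E *m E = E -> \tr E = (\rank E)%:R.
Proof.
move=> EE; have bE := mulmx_base E.
suff e1 : row_base E *m col_base E = 1%:M.
  by rewrite -{1}bE mxtrace_mulC e1 mxtrace1.
apply: (row_free_inj (row_base_free E)); apply: (row_full_inj (col_base_full E)) => /=.
have -> : col_base E *m (row_base E *m col_base E *m row_base E)
    = (col_base E *m row_base E) *m (col_base E *m row_base E) by rewrite !mulmxA.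
by rewrite mul1mx bE.
Qed.

(** Z / c and its restriction to [U] are idempotent, so their traces are ranks. In characteristic
    zero the traces agree iff the ranks do, that is, iff the image of [Z] is already the image of
    [U]. *)
Lemma trace_on_quotient (c : F) (U Z : 'M[F]_m) : c != 0 -> Z *m Z = c *: Z ->
  (U *m Z <= U)%MS ->
  (\tr Z - \tr (row_base U *m Z *m pinvmx (row_base U)) = 0) <-> (Z <= U)%MS.
Proof.
move=> c0 ZZ UZ; pose E := c^-1 *: Z.
have ZE : Z = c *: E by rewrite scalerA divff // scale1r.
have EE : E *m E = E.
  by rewrite -scalemxAl -scalemxAr ZZ !scalerA -mulrA mulVf // mulr1.
have subE : (Z <= U)%MS = (E <= U)%MS by rewrite ZE eqmx_scale.
set B := row_base U.
have -> : \tr Z - \tr (B *m Z *m pinvmx B) = c * (\tr E - \tr (B *m E *m pinvmx B)).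
  by rewrite mulrBr -!mxtraceZ -ZE scalemxAl scalemxAr -ZE.
rewrite subE.
have BE : (B *m E <= B)%MS.
  rewrite eq_row_base -scalemxAr (submx_trans (scalemx_sub _ (submx_refl _))) //.
  by rewrite (submx_trans _ UZ) // submxMr // eq_row_base.
pose R := B *m E *m pinvmx B.
have RB : R *m B = B *m E by rewrite /R mulmxKpV.
have fB : row_free B by apply: row_base_free.
have RR : R *m R = R.
  by apply: (row_free_inj fB) => /=; rewrite -mulmxA RB mulmxA RB -mulmxA EE.
rewrite -/R (mxtrace_idempotent EE) (mxtrace_idempotent RR).
have -> : \rank R = \rank (B *m E) by rewrite -RB mxrankMfree.
have le : (B *m E <= E)%MS by apply: submxMl.
split=> [/eqP|EU].
  rewrite mulf_eq0 (negPf c0) /= subr_eq0 => /eqP e.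
  have re : \rank E = \rank (B *m E).
    have := mxrankS le; rewrite leq_eqVlt => /orP [/eqP -> //|lt].
    have /eqP := e; rewrite -subr_eq0 -natrB ?(ltnW lt) // char0_natr_eq0; lia.
  have : (E <= B *m E)%MS by rewrite -(mxrank_leqif_sup le) re.
  by move=> /submx_trans; apply; rewrite (submx_trans BE) // eq_row_base.
have -> : \rank (B *m E) = \rank E.
  apply/eqP; rewrite (mxrank_leqif_sup le) -{1}EE submxMr //.
  by rewrite eq_row_base.
by rewrite subrr mulr0.
Qed.

End LinearAlgebra.

Local Notation gact := Pilot.Defs.gact.

Section GroupAction.
Variable n : 'I_4 -> nat.
Implicit Types (g h : Grp n).

Definition gmul g h : Grp n := [ffun t => (g t * h t)%g].

Definition gone : Grp n := [ffun t => 1%g].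

Definition gins (t : 'I_4) (s : {perm 'I_(n t)}) : Grp n :=
  [ffun t' => dfwith (fun t => 1%g : {perm 'I_(n t)}) s t'].

Lemma gactM g h x : gact (gmul g h) x = gact h (gact g x).
Proof. by rewrite /gact /= ffunE permM. Qed.

Lemma gact_inj g : injective (gact g).
Proof.
apply: (can_inj (g := gact (Ginv g))) => -[t x]; rewrite -gactM /gact /=.
by rewrite !ffunE mulgV perm1.
Qed.

Definition gperm g : {perm Xvar n} := perm (@gact_inj g).

Lemma gins_in t (s : {perm 'I_(n t)}) : gins s t = s.
Proof. by rewrite ffunE dfwith_in. Qed.

Lemma gins_out t (s : {perm 'I_(n t)}) t' : t != t' -> gins s t' = 1%g.
Proof. by move=> tt'; rewrite ffunE dfwith_out. Qed.

Lemma ginsM t (s s' : {perm 'I_(n t)}) : gins (s * s')%g = gmul (gins s) (gins s').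
Proof.
apply/ffunP => t'; rewrite [RHS]ffunE; have [<-|ne] := eqVneq t t'.
  by rewrite !gins_in.
by rewrite !gins_out // mulg1.
Qed.

Lemma gmulK h : cancel (gmul^~ h) (gmul^~ (Ginv h)).
Proof. by move=> g; apply/ffunP => t; rewrite !ffunE mulgK. Qed.

Lemma gmulVK h : cancel (gmul^~ (Ginv h)) (gmul^~ h).
Proof. by move=> g; apply/ffunP => t; rewrite !ffunE mulgVK. Qed.

Definition shift g (a : 'I_(Pdim n)) : 'I_(Pdim n) := enum_rank (monOf a * gperm g)%g.

Lemma monOf_shift g a : monOf (shift g a) = (monOf a * gperm g)%g.
Proof. by rewrite /monOf /shift enum_rankK. Qed.

Lemma gmatE (F : fieldType) g : gmat F g = \matrix_(a, b) (b == shift g a)%:R.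
Proof.
apply/matrixP => a b; rewrite !mxE; congr (nat_of_bool _)%:R.
apply/forallP/eqP => [h|-> x]; last by rewrite monOf_shift permM permE.
apply: enum_val_inj; rewrite -[LHS]/(monOf b) -[RHS]/(monOf (shift g a)) monOf_shift.
by apply/permP => x; rewrite permM permE (eqP (h x)).
Qed.

Lemma shiftM g h a : shift (gmul g h) a = shift h (shift g a).
Proof.
apply: enum_val_inj; rewrite -[LHS]/(monOf _) -[RHS]/(monOf _) !monOf_shift -mulgA.
by congr (_ * _)%g; apply/permP => x; rewrite permM !permE gactM.
Qed.

Lemma gmatM (F : fieldType) g h : gmat F (gmul g h) = gmat F g *m gmat F h.
Proof.
apply/matrixP => a b; rewrite !gmatE !mxE (bigD1 (shift g a)) //= !mxE eqxx mul1r shiftM.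
by rewrite big1 ?addr0 // => c /negPf ca; rewrite !mxE ca mul0r.
Qed.

Lemma gmat1 (F : fieldType) : gmat F gone = 1%:M.
Proof.
apply/matrixP => a b; rewrite gmatE !mxE; congr (nat_of_bool _)%:R.
have -> : shift gone a = a; last by rewrite eq_sym.
apply: enum_val_inj; rewrite -[LHS]/(monOf _) monOf_shift.
apply/permP => x; rewrite permM permE /gact ffunE perm1.
by case: (monOf a x).
Qed.

Lemma mul_row_gmat (F : fieldType) g a :
  delta_mx 0 a *m gmat F g = delta_mx 0 (shift g a) :> 'rV_(Pdim n).
Proof.
apply/rowP => b; rewrite !mxE (bigD1 a) //= gmatE !mxE !eqxx mul1r eq_sym /=.
by rewrite big1 ?addr0 // => c /negPf ca; rewrite !mxE ca andbF mul0r.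
Qed.

End GroupAction.

Section Cocharacter.
Variables (F : fieldType) (charF0 : [pchar F] =i pred0).
Variables (V : lmodType F) (mul : V -> V -> V) (A0 A1 : V -> Prop) (inv : V -> V).
Variable n : 'I_4 -> nat.
Local Notation IdP := (IdP mul A0 A1 inv n).
Local Notation is_sid := (@is_sid F V mul A0 A1 inv n).
Implicit Types (g h : Grp n) (lam : 'I_4 -> seq nat) (U W : 'M[F]_(Pdim n)).

Definition mon_value (s : Xvar n -> V) (a : 'I_(Pdim n)) : V :=
  evalw mul (map s (monw (monOf a))).

Lemma mon_value_shift s g a : mon_value s (shift g a) = mon_value (s \o gact g) a.
Proof.
rewrite /mon_value; congr (evalw _ _); rewrite /monw -!map_comp; apply: eq_map => x /=.
by rewrite monOf_shift permM permE.
Qed.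

(** [IdP] is chosen by [epsilon]; its specification holds because the identities form a subspace,
    hence a row space. *)
Lemma IdPP (f : 'rV_(Pdim n)) : (f <= IdP)%MS <-> is_sid f.
Proof.
move: f; apply: (epsilon_spec (inhabits 0) (fun U : 'M[F]_(Pdim n) =>
  forall f : 'rV_(Pdim n), (f <= U)%MS <-> is_sid f)).
apply: exists_span_matrix => [s _|a f f' sf sf' s hs].
  by rewrite big1 // => a _; rewrite mxE scale0r.
under eq_bigr do rewrite !mxE scalerDl -scalerA.
by rewrite big_split /= -scaler_sumr sf // sf' // scaler0 addr0.
Qed.

Lemma sid_gmat f g : is_sid f -> is_sid (f *m gmat F g).
Proof.
move=> sf s hs.
transitivity (\sum_(a < Pdim n) f 0 a *: mon_value s (shift g a)).
  under eq_bigr do rewrite mxE scaler_suml.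
  rewrite exchange_big /=; apply: eq_bigr => a _.
  rewrite (bigD1 (shift g a)) //= gmatE mxE eqxx mulr1 big1 ?addr0 // => b /negPf ba.
  by rewrite mxE ba mulr0 scale0r.
under eq_bigr do rewrite mon_value_shift.
by apply: sf => x; apply: hs (gact g x).
Qed.

Lemma IdP_gmat g : (IdP *m gmat F g <= IdP)%MS.
Proof.
apply/row_subP => i; rewrite row_mul; apply/IdPP/sid_gmat/IdPP.
exact: row_sub.
Qed.

Lemma sub_IdP_gmat m (W : 'M[F]_(m, Pdim n)) g : (W <= IdP)%MS -> (W *m gmat F g <= IdP)%MS.
Proof. by move=> WU; apply: submx_trans (IdP_gmat g); apply: submxMr. Qed.

(** The matrix of z_lam, a nonzero multiple of the projection onto the component of type [lam] when
    [lam] consists of partitions. *)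
Definition isotypic_mx lam : 'M[F]_(Pdim n) := \sum_(g : Grp n) chi4 F lam g *: gmat F g.

Lemma chi4V lam g : chi4 F lam (Ginv g) = chi4 F lam g.
Proof. by apply: eq_bigr => t _; rewrite ffunE ScharV. Qed.

Lemma isotypic_mx_mul lam (phi : Grp n -> F) :
  isotypic_mx lam *m (\sum_h phi h *: gmat F h)
    = \sum_g (\sum_h chi4 F lam (gmul g (Ginv h)) * phi h) *: gmat F g.
Proof.
rewrite /isotypic_mx mulmx_sumr.
transitivity (\sum_h \sum_g (chi4 F lam (gmul g (Ginv h)) * phi h) *: gmat F g).
  apply: eq_bigr => h _; rewrite mulmx_suml.
  rewrite (reindex (fun g : Grp n => gmul g (Ginv h))) /=; last first.
    by exists (fun g : Grp n => gmul g h) => g _; [apply: gmulVK|apply: gmulK].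
  apply: eq_bigr => g _; rewrite -scalemxAl -scalemxAr scalerA -gmatM.
  by rewrite gmulVK.
by rewrite exchange_big /=; apply: eq_bigr => g _; rewrite scaler_suml.
Qed.

Lemma isotypic_mx_mul_gmat lam h :
  isotypic_mx lam *m gmat F h = \sum_g chi4 F lam (gmul g (Ginv h)) *: gmat F g.
Proof.
have -> : gmat F h = \sum_h' (h' == h)%:R *: gmat F h'.
  rewrite (bigD1 h) //= eqxx scale1r big1 ?addr0 // => h' /negPf ->.
  by rewrite scale0r.
rewrite isotypic_mx_mul; apply: eq_bigr => g _; congr (_ *: _).
rewrite (bigD1 h) //= eqxx mulr1 big1 ?addr0 // => h' /negPf ->.
by rewrite mulr0.
Qed.

Lemma chi4_gins lam g t (y : {perm 'I_(n t)}) :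
  chi4 F lam (gmul g (Ginv (gins y)))
    = (Schar (lam t) (g t * y^-1)%g)%:~R
      * \prod_(t' < 4 | t' != t) (Schar (lam t') (g t'))%:~R.
Proof.
rewrite /chi4 (bigD1 t) //= !ffunE dfwith_in; congr (_ * _).
apply: eq_bigr => t' tt'; rewrite !ffunE dfwith_out 1?eq_sym //.
by rewrite invg1 mulg1.
Qed.

Section Partition.
Variable lam : 'I_4 -> seq nat.
Hypothesis pl : forall t, is_partition (n t) (lam t).

Let x1 t : F := (Schar (lam t) (1%g : {perm 'I_(n t)}))%:~R.

Lemma Schar1F_neq0 t : x1 t != 0.
Proof. by rewrite char0_intr_eq0 // Schar1_neq0. Qed.

Lemma isotypic_mx_sqr :
  isotypic_mx lam *m isotypic_mx lam = (\prod_t ((n t)`!%:R / x1 t)) *: isotypic_mx lam.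
Proof.
rewrite [X in _ *m X]/isotypic_mx isotypic_mx_mul scaler_sumr; apply: eq_bigr => g _.
rewrite scalerA; congr (_ *: _).
rewrite /chi4 -big_split /=.
transitivity (\prod_(t < 4) \sum_(s : {perm 'I_(n t)})
   ((Schar (lam t) (g t * s^-1)%g)%:~R * (Schar (lam t) s)%:~R : F)).
  rewrite bigA_distr_dffun; apply: eq_bigr => h _; rewrite -big_split /=.
  by apply: eq_bigr => t _; rewrite !ffunE.
apply: eq_bigr => t _; apply: (mulfI (Schar1F_neq0 t)).
rewrite [in RHS]mulrA [x1 t * (_ / _)]mulrC mulfVK ?Schar1F_neq0 //.
have := congr1 (fun z : int => z%:~R : F)
  (@Schar_conv _ _ (pl t) (fun s => Schar (lam t) s) (g t) (@ScharJ _ (lam t))).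
rewrite (Schar_norm (pl t)) !rmorphM rmorph_sum /= rmorph_nat => <-.
by congr (_ * _); apply: eq_bigr => s _; rewrite rmorphM.
Qed.

Lemma isotypic_mx_scale_neq0 : \prod_t ((n t)`!%:R / x1 t) != 0.
Proof.
apply/prodf_neq0 => t _; rewrite mulf_neq0 ?invr_neq0 ?Schar1F_neq0 //.
by rewrite char0_natr_eq0 // -lt0n fact_gt0.
Qed.

Lemma IdP_mul_isotypic_mx : (IdP *m isotypic_mx lam <= IdP)%MS.
Proof.
rewrite mulmx_sumr; apply: summx_sub => g _; rewrite -scalemxAr.
by apply: scalemx_sub; apply: IdP_gmat.
Qed.

(** Traces are linear and [chi4] is invariant under inversion, so the multiplicity is the trace of
    z_lam on the quotient divided by the group order. *)
Lemma mult_eq0P : mult mul A0 A1 inv n lam = 0 <-> (isotypic_mx lam <= IdP)%MS.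
Proof.
rewrite -(trace_on_quotient charF0 isotypic_mx_scale_neq0 isotypic_mx_sqr IdP_mul_isotypic_mx).
have -> : mult mul A0 A1 inv n lam = (#|{: Grp n}|%:R)^-1 *
   (\tr (isotypic_mx lam) - \tr (row_base IdP *m isotypic_mx lam *m pinvmx (row_base IdP))).
  congr (_ * _).
  have -> : \tr (isotypic_mx lam) = \sum_(g : Grp n) chi4 F lam g * \tr (gmat F g).
    by rewrite /isotypic_mx raddf_sum; apply: eq_bigr => g _ /=; rewrite mxtraceZ.
  have -> : \tr (row_base IdP *m isotypic_mx lam *m pinvmx (row_base IdP)) =
      \sum_(g : Grp n) chi4 F lam g * \tr (row_base IdP *m gmat F g *m pinvmx (row_base IdP)).
    rewrite /isotypic_mx mulmx_sumr mulmx_suml raddf_sum; apply: eq_bigr => g _ /=.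
    by rewrite -scalemxAr -scalemxAl mxtraceZ.
  by rewrite -sumrB; apply: eq_bigr => g _; rewrite chi4V -mulrBr mulrC.
have g0 : (#|{: Grp n}|%:R : F) != 0.
  by rewrite char0_natr_eq0 // -lt0n; apply/card_gt0P; exists (gone n).
split=> [/eqP|->]; last by rewrite mulr0.
by rewrite mulf_eq0 invr_eq0 (negPf g0) => /eqP.
Qed.

Section Amitsur.
Variables (t : 'I_4) (k : nat) (j : 'I_k -> 'I_(n t)) (inj_j : injective j).
Variable mu : seq nat.
Hypothesis pm : is_partition k mu.

Definition amitsur_mx : 'M[F]_(Pdim n) :=
  \sum_(s : {perm 'I_k}) (Schar mu s)%:~R *: gmat F (gins (ext inj_j s)).

(** Only the factor of kind [t] matters: each coefficient of the product contains one of the sums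
    annihilated by [Schar_restr_eq0]. *)
Lemma isotypic_mx_mul_amitsur_mx_eq0 :
  ~ (forall i, (nth 0 mu i <= nth 0 (lam t) i)%N) -> isotypic_mx lam *m amitsur_mx = 0.
Proof.
move=> nsub; have br0 : \sum_(s : {perm 'I_k}) Schar (lam t) (ext inj_j s) * Schar mu s = 0.
  by apply/eqP; case: eqP => // /eqP /(Schar_branching inj_j (pl t) pm).
rewrite /amitsur_mx mulmx_sumr.
under eq_bigr do rewrite -scalemxAr isotypic_mx_mul_gmat scaler_sumr.
rewrite exchange_big /= big1 // => g _.
under eq_bigr do rewrite scalerA chi4_gins mulrA.
rewrite -scaler_suml -mulr_suml.
have -> : \sum_(s : {perm 'I_k}) ((Schar mu s)%:~R *
    (Schar (lam t) (g t * (ext inj_j s)^-1)%g)%:~R : F) = 0.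
  have := congr1 (fun z : int => z%:~R : F) (Schar_restr_eq0 (pl t) pm br0 (g t)).
  rewrite rmorph_sum /= => e; rewrite -[RHS]e; apply: eq_bigr => s _.
  by rewrite rmorphM mulrC.
by rewrite mul0r scale0r.
Qed.

(** The image of each conjugate of [amitsur_mx] consists of identities, since renaming variables
    preserves them; z_lam times the sum of the conjugates is a nonzero multiple of z_lam. *)
Lemma isotypic_mx_sub_of_amitsur_mx : (forall i, nth 0 mu i <= nth 0 (lam t) i)%N ->
  (amitsur_mx <= IdP)%MS -> (isotypic_mx lam <= IdP)%MS.
Proof.
move=> /(Schar_branching inj_j (pl t) pm) br YU.
set b := \sum_(s : {perm 'I_k}) _ in br.
(* The scalar of [Schar_conv_avg]: n_t! times the branching number, divided by the degree. *)
pose om : F := (n t)`!%:R * b%:~R / x1 t.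
have om0 : om != 0.
  by rewrite !mulf_neq0 ?invr_neq0 ?Schar1F_neq0 ?char0_intr_eq0 ?char0_natr_eq0 // -lt0n fact_gt0.
have e : \sum_(h : {perm 'I_(n t)}) isotypic_mx lam *m
      (gmat F (gins h^-1) *m amitsur_mx *m gmat F (gins h))
    = om *: isotypic_mx lam.
  transitivity (\sum_(h : {perm 'I_(n t)}) \sum_(s : {perm 'I_k}) \sum_(g : Grp n)
     ((Schar mu s)%:~R * chi4 F lam (gmul g (Ginv (gins (ext inj_j s ^ h)%g)))) *: gmat F g).
    apply: eq_bigr => h _; rewrite /amitsur_mx mulmx_sumr mulmx_suml mulmx_sumr.
    apply: eq_bigr => s _; rewrite -scalemxAr -scalemxAl -scalemxAr -!gmatM -!ginsM.
    by rewrite -mulgA -conjgE isotypic_mx_mul_gmat scaler_sumr; apply: eq_bigr => g _; rewrite scalerA.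
  under eq_bigr do rewrite exchange_big /=.
  rewrite exchange_big /= scaler_sumr; apply: eq_bigr => g _.
  under eq_bigr do rewrite -scaler_suml.
  rewrite -scaler_suml scalerA; congr (_ *: _).
  under eq_bigr => h _ do under eq_bigr => s _ do rewrite chi4_gins mulrA.
  under eq_bigr => h _ do rewrite -mulr_suml.
  rewrite -mulr_suml [in RHS]/chi4 [in RHS](bigD1 t) //= mulrA; congr (_ * _).
  have := congr1 (fun z : int => z%:~R : F) (Schar_conv_avg inj_j mu (pl t) (g t)).
  rewrite -/b !rmorphM rmorph_sum /= rmorph_nat => e.
  apply: (mulfI (Schar1F_neq0 t)); rewrite /om.
  rewrite [in RHS]mulrA [x1 t * (_ / _)]mulrC mulfVK ?Schar1F_neq0 // -e; congr (_ * _).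
  apply: eq_bigr => h _; rewrite rmorph_sum /=; apply: eq_bigr => s _.
  by rewrite rmorphM mulrC.
suff : (om *: isotypic_mx lam <= IdP)%MS by rewrite eqmx_scale.
rewrite -e; apply: summx_sub => h _; rewrite !mulmxA.
apply: sub_IdP_gmat; apply: submx_trans YU; exact: submxMl.
Qed.

End Amitsur.
End Partition.

(** Completeness in each of the four factors writes 1 as a combination of the z_lam, so [W] is a sum
    of multiples of the products in the hypothesis. *)
Lemma sub_IdP_of_isotypic_mx W :
  (forall lam, (forall t, is_partition (n t) (lam t)) -> (isotypic_mx lam *m W <= IdP)%MS) ->
  (W <= IdP)%MS.
Proof.
move=> ZW.
(* The coefficients are 0 at exponents that encode no partition, so the sums may range over the
   whole finite type. *)
pose cf t (v : beta_set (n t)) (s : {perm 'I_(n t)}) : F :=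
  (is_beta v)%:R * ((n t)`!%:R^-1 * (frob_char v (1%g : {perm 'I_(n t)}))%:~R) * (frob_char v s)%:~R.
have one t (s : {perm 'I_(n t)}) : \sum_(v : beta_set (n t)) cf t v s = (s == 1%g)%:R.
  have n0 : ((n t)`!%:R : F) != 0 by rewrite char0_natr_eq0 // -lt0n fact_gt0.
  have := congr1 (fun z : int => z%:~R : F) (frob_char_complete s).
  rewrite rmorph_nat natrM rmorph_sum big_mkcond /= => e.
  apply: (mulfI n0); rewrite -e mulr_sumr; apply: eq_bigr => v _.
  rewrite /cf; case: (is_beta v); last by rewrite !mul0r mulr0.
  by rewrite mul1r !mulrA divff // mul1r rmorphM.
have -> : W = \sum_(vv : {dffun forall t : 'I_4, beta_set (n t)})
   (\sum_(g : Grp n) (\prod_t cf t (vv t) (g t)) *: gmat F g) *m W.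
  rewrite -mulmx_suml exchange_big /=.
  under eq_bigr => g _ do rewrite -scaler_suml -(bigA_distr_dffun (fun t v => cf t v (g t))).
  rewrite (bigD1 (gone n)) //= big1 ?scale1r => [|t _]; last first.
    by rewrite one ffunE eqxx.
  rewrite big1 ?addr0 ?gmat1 ?mul1mx // => g g1.
  have [t gt1] : exists t, g t != 1%g.
    apply/existsP; apply: contraNT g1 => /existsPn h; apply/eqP/ffunP => t.
    by rewrite ffunE; have := h t; rewrite negbK => /eqP.
  by rewrite (bigD1 t) //= one (negPf gt1) mul0r scale0r.
apply: summx_sub => vv _.
have [/forallP bv|] := boolP [forall t, is_beta (vv t)]; last first.
  rewrite negb_forall => /existsP [t /negPf nb].
  rewrite (_ : \sum_g _ = 0) ?mul0mx ?sub0mx // big1 // => g _.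
  by rewrite (bigD1 t) //= /cf nb !mul0r scale0r.
pose lam t := beta_shape (vv t).
have pl t : is_partition (n t) (lam t) by have [] := is_betaP (bv t).
have -> : \sum_(g : Grp n) (\prod_t cf t (vv t) (g t)) *: gmat F g =
   (\prod_t ((n t)`!%:R^-1 * (frob_char (vv t) (1%g : {perm 'I_(n t)}))%:~R)) *: isotypic_mx lam.
  rewrite /isotypic_mx scaler_sumr; apply: eq_bigr => g _; rewrite scalerA; congr (_ *: _).
  rewrite /chi4 -big_split /=; apply: eq_bigr => t _; rewrite /cf bv mul1r.
  by rewrite ScharE; have [_ ->] := is_betaP (bv t).
by rewrite -scalemxAl; apply: scalemx_sub; apply: ZW.
Qed.

End Cocharacter.

(** * Amitsur words *)

Section Words.
Variables (F : fieldType) (V : lmodType F) (mul : V -> V -> V).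
Hypothesis mulDl : forall (a : F) x y z, mul (a *: x + y) z = a *: mul x z + mul y z.
Hypothesis mulDr : forall (a : F) x y z, mul z (a *: x + y) = a *: mul z x + mul z y.
Hypothesis mulA : forall x y z, mul x (mul y z) = mul (mul x y) z.

(* Products in the unitisation restricted to monomials: None is the unit. *)
Definition omul (x y : option V) : option V :=
  match x, y with
  | None, _ => y
  | _, None => x
  | Some a, Some b => Some (mul a b)
  end.

Arguments omul : simpl never.

Lemma omulA : associative omul.
Proof. by case=> [x|] [y|] [z|] //; rewrite /omul mulA. Qed.

Lemma omul1x : left_id None omul.
Proof. by case. Qed.

Lemma omulx1 : right_id None omul.
Proof. by case. Qed.

HB.instance Definition _ := Monoid.isLaw.Build (option V) None omul omulA omul1x omulx1.

Lemma evalwE w : evalw mul w = odflt 0 (\big[omul/None]_(x <- w) Some x).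
Proof.
case: w => [|x w]; first by rewrite big_nil.
rewrite big_cons /evalw; elim: w x => [|y w IH] x /=; first by rewrite big_nil.
by rewrite IH big_cons omulA.
Qed.

Lemma omul_additive (p q : option V) (v w : V) :
  odflt 0 (omul (omul p (Some (v + w))) q)
    = odflt 0 (omul (omul p (Some v)) q) + odflt 0 (omul (omul p (Some w)) q).
Proof.
have Dl x y z : mul (x + y) z = mul x z + mul y z.
  by rewrite -[x]scale1r mulDl !scale1r.
have Dr x y z : mul z (x + y) = mul z x + mul z y.
  by rewrite -[x]scale1r mulDr !scale1r.
by case: p q => [p|] [q|]; rewrite /omul /= ?Dr ?Dl.
Qed.

Lemma omul_additive_sum (p q : option V) (f : 'I_4 -> V) :
  odflt 0 (omul (omul p (Some (\sum_t f t))) q)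
    = \sum_t odflt 0 (omul (omul p (Some (f t))) q).
Proof.
rewrite !big_ord_recl !big_ord0 !omul_additive; congr (_ + (_ + (_ + (_ + _)))).
have := omul_additive p q 0 0; rewrite addr0 => /esym /eqP.
by rewrite -subr_eq0 addrK => /eqP.
Qed.

(* Value of b_0 c_0 b_1 c_1 ... b_k c_k, where absent letters are None. *)
Definition interleave (b : nat -> option V) (cs : seq (option V)) : option V :=
  \big[omul/None]_(0 <= j < (size cs).+1) omul (b j) (nth None cs j).

Lemma amitsur_evalE k (a : 'I_k -> V) (b : 'I_k.+1 -> option V) (bn : nat -> option V)
    (s : {perm 'I_k}) : (forall j : 'I_k.+1, b j = bn j) ->
  evalw mul (amitsur_word a b s) =
  odflt 0 (interleave bn [seq Some (a (s x)) | x <- enum 'I_k]).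
Proof.
move=> bE; rewrite evalwE; congr (odflt 0 _).
rewrite /amitsur_word big_cat big_flatten big_map /=.
(* There is one more block than special letters: the last block is paired with the default [None],
   the unit. *)
rewrite /interleave size_map size_enum_ord big_nat_recr //= [nth None _ k]nth_default; last first.
  by rewrite size_map size_enum_ord.
have oppE (o : option V) : \big[omul/None]_(x <- oapp (fun v => [:: v]) [::] o) Some x = o.
  by case: o => [v|]; rewrite ?big_seq1 ?big_nil.
rewrite omulx1 oppE (bE ord_max); congr (omul _ _).
rewrite /index_iota subn0 -val_enum_ord big_map; apply: eq_bigr => j _.
rewrite big_cat big_seq1 oppE bE /=; congr (omul _ _).
by rewrite (nth_map j) ?size_enum_ord // nth_ord_enum.
Qed.

(** The same [p] and [q] serve for every value of the m-th block, which exposes the product as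
    additive in that block. *)
Lemma interleave_update b cs m x : (m <= size cs)%N ->
  exists p q, (forall y, interleave (fun j => if j == m then Some y else b j) cs
                = omul (omul p (Some y)) q) /\
              (b m = Some x -> interleave b cs = omul (omul p (Some x)) q).
Proof.
move=> ms.
exists (\big[omul/None]_(0 <= j < m) omul (b j) (nth None cs j)).
exists (omul (nth None cs m)
  (\big[omul/None]_(m.+1 <= j < (size cs).+1) omul (b j) (nth None cs j))).
have split (b' : nat -> option V) : interleave b' cs =
  omul (omul (\big[omul/None]_(0 <= j < m) omul (b' j) (nth None cs j)) (b' m))
    (omul (nth None cs m) (\big[omul/None]_(m.+1 <= j < (size cs).+1) omul (b' j) (nth None cs j))).
  rewrite /interleave (big_cat_nat (n := m)) //=; last exact: leqW.
  by rewrite [X in omul _ X]big_ltn // !omulA.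
split=> [y|bm]; rewrite split ?bm // eqxx; congr (omul (omul _ _) (omul _ _)).
  by apply: eq_big_nat => j /andP [_ jm]; rewrite ltn_eqF.
by apply: eq_big_nat => j /andP [mj _]; rewrite gtn_eqF.
Qed.

(** The runs of non-special letters are multiplied into blocks that depend on [rho0] only, so one
    [b] serves for all rearrangements of the special values. *)
Lemma word_interleave (T : eqType) (sp : pred T) (rho0 : T -> V) (w : seq T) :
  exists b : nat -> option V, forall rho : T -> V,
    (forall x, ~~ sp x -> rho x = rho0 x) ->
    \big[omul/None]_(x <- w) Some (rho x)
      = interleave b [seq Some (rho x) | x <- w & sp x].
Proof.
elim: w => [|x w [b IH]].
  by exists (fun _ => None) => rho _; rewrite /interleave big_nil big_nat1.
have [spx|nspx] := boolP (sp x).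
  exists (fun j => if j is j'.+1 then b j' else None) => rho h.
  by rewrite big_cons (IH rho h) /= spx /interleave /= [RHS]big_nat_recl.
exists (fun j => if j is 0 then omul (Some (rho0 x)) (b 0) else b j) => rho h.
rewrite big_cons (IH rho h) /= (negPf nspx) (h x nspx) /interleave.
by rewrite !big_nat_recl //= !omulA.
Qed.

Section Identities.
Variables (A0 A1 : V -> Prop) (inv : V -> V).
Local Notation Aset := (Aset A0 A1 inv).
Hypothesis decomposition : forall v, exists f : 'I_4 -> V,
  (forall t, Aset t (f t)) /\ v = \sum_t f t.
Variables (d l : 'I_4 -> nat).

(** The x_j in E take values of a single kind or are absent, whereas a block of several letters may
    be any element. By additivity each block is split into its four components, one position at a
    time. *)
Lemma satisfies_E_interleave (i : 'I_4) (a : 'I_(kk d l i) -> V) (b : nat -> option V) :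
  satisfies_E mul A0 A1 inv d l -> (forall j, Aset i (a j)) ->
  \sum_(s : {perm 'I_(kk d l i)}) (Schar (rect (d i) (l i)) s)%:~R *:
     odflt 0 (interleave b [seq Some (a (s x)) | x <- enum 'I_(kk d l i)]) = 0.
Proof.
move=> hE ha; set k := kk d l i in a ha *.
(* Positions from [m] on are already of a single kind: m = 0 is an instance of E, and m = k + 1 is
   no condition at all. *)
pose hom m (b : nat -> option V) := forall j v, (m <= j < k.+1)%N -> b j = Some v ->
  exists t, Aset t v.
suff main m : (m <= k.+1)%N -> forall b, hom m b ->
  \sum_(s : {perm 'I_k}) (Schar (rect (d i) (l i)) s)%:~R *:
     odflt 0 (interleave b [seq Some (a (s x)) | x <- enum 'I_k]) = 0.
  by apply: (main k.+1) => // j v; lia.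
elim: m => [_ {}b hb|m IH mk {}b hb].
  have /fin_all_exists [cv cvP] : forall j : 'I_k.+1, exists cv : option 'I_4 * V,
      b j = omap (fun _ => cv.2) cv.1 /\ (forall t, cv.1 = Some t -> Aset t cv.2).
    move=> j; case bj : (b j) => [v|]; last by exists (None, 0).
    by have [t tv] := hb j v (ltn_ord j) bj; exists (Some t, v); split=> // t' [<-].
  rewrite -[RHS](hE i (fun j => (cv j).1) a (fun j => (cv j).2) ha); last first.
    by move=> j t; have [_] := cvP j; apply.
  apply: eq_bigr => s _; congr (_ *: _); apply/esym/amitsur_evalE => j.
  by have [-> _] := cvP j.
case bm : (b m) => [v|]; last first.
  apply: IH => [|j w jm bj]; first exact: ltnW.
  have [e|ne] := eqVneq j m; first by rewrite e bm in bj.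
  by apply: (hb j w) => //; lia.
have [f [fA vE]] := decomposition v.
transitivity (\sum_t \sum_(s : {perm 'I_k}) (Schar (rect (d i) (l i)) s)%:~R *:
   odflt 0 (interleave (fun j => if j == m then Some (f t) else b j)
     [seq Some (a (s x)) | x <- enum 'I_k])).
  rewrite exchange_big /=; apply: eq_bigr => s _; rewrite -scaler_sumr; congr (_ *: _).
  have ms : (m <= size [seq Some (a (s x)) | x <- enum 'I_k])%N.
    by rewrite size_map size_enum_ord.
  have [p [q [e1 e2]]] := @interleave_update b _ m v ms.
  rewrite (e2 bm) vE omul_additive_sum.
  by apply: eq_bigr => t _; rewrite e1.
rewrite big1 // => t _; apply: IH => [|j w jm]; first exact: ltnW.
by case: eqVneq => [e [<-]|ne bj]; [exists t|apply: (hb j w) => //; lia].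
Qed.

Variable n : 'I_4 -> nat.
Variables (t : 'I_4) (k : nat) (j : 'I_k -> 'I_(n t)) (inj_j : injective j).

Definition Jvar (y : 'I_k) : Xvar n := Tagged (fun t => 'I_(n t)) (j y).

Lemma gact_gins_in s y : gact (gins (ext inj_j s)) (Jvar y) = Jvar (s y).
Proof. by rewrite /gact /= gins_in ext_in. Qed.

Lemma gact_gins_out s x : x \notin codom Jvar -> gact (gins (ext inj_j s)) x = x.
Proof.
case: x => t' p nx; rewrite /gact /=; congr (Tagged _ _).
have [e|ne] := eqVneq t t'; last by rewrite gins_out // perm1.
case: t' / e in p nx *; rewrite gins_in ext_out //.
by apply: contra nx => /codomP [y ->]; apply/codomP; exists y.
Qed.

Lemma Jvar_inj : injective Jvar.
Proof. by move=> y y' /eqP; rewrite eq_Tagged => /eqP /inj_j. Qed.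

Variable mu : seq nat.

Lemma amitsur_mx_sid (a : 'I_(Pdim n)) :
  is_sid mul A0 A1 inv (delta_mx 0 a *m amitsur_mx F inj_j mu) <->
  (forall s : Xvar n -> V, (forall x, Aset (tag x) (s x)) ->
    \sum_(p : {perm 'I_k}) (Schar mu p)%:~R *:
      mon_value mul (s \o gact (gins (ext inj_j p))) a = 0).
Proof.
have E s : \sum_(b < Pdim n) ((delta_mx 0 a : 'rV_(Pdim n)) *m amitsur_mx F inj_j mu) 0 b *:
     evalw mul (map s (monw (monOf b))) =
   \sum_(p : {perm 'I_k}) (Schar mu p)%:~R *:
      mon_value mul (s \o gact (gins (ext inj_j p))) a.
  rewrite /amitsur_mx mulmx_sumr.
  under eq_bigr do rewrite summxE scaler_suml.
  rewrite exchange_big /=; apply: eq_bigr => p _.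
  rewrite -mon_value_shift (bigD1 (shift (gins (ext inj_j p)) a)) //=.
  rewrite -scalemxAr mul_row_gmat !mxE !eqxx mulr1 big1 ?addr0 // => b /negPf ba.
  by rewrite !mxE ba andbF mulr0 scale0r.
by split=> h s hs; have := h s hs; rewrite E.
Qed.

(** [tau] records the order in which the special variables occur in the word. *)
Lemma codom_order (T : finType) (f : 'I_k -> T) (w : seq T) : injective f ->
  uniq w -> (forall x, x \in w) -> exists tau : {perm 'I_k},
    [seq x <- w | x \in codom f] = [seq f (tau y) | y <- enum 'I_k].
Proof.
move=> inj_f uw wT.
have szc : size (codom f) == k by rewrite size_codom card_ord.
have : perm_eq [seq x <- w | x \in codom f] (Tuple szc).
  apply: uniq_perm; first exact: filter_uniq.
    by rewrite /= map_inj_uniq ?enum_uniq.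
  by move=> x; rewrite mem_filter wT andbT.
case/tuple_permP => tau ->; exists tau => /=; apply: eq_map => y.
by rewrite (tnth_nth (f y)) /= codomE (nth_map y) ?size_enum_ord // nth_ord_enum.
Qed.

End Identities.

Lemma amitsur_mx_sub_of_E (A0 A1 : V -> Prop) (inv : V -> V) (d l n : 'I_4 -> nat) (i : 'I_4)
    (j : 'I_(kk d l i) -> 'I_(n i)) (inj_j : injective j) :
  (forall v, exists f : 'I_4 -> V,
     (forall t, Aset A0 A1 inv t (f t)) /\ v = \sum_t f t) ->
  satisfies_E mul A0 A1 inv d l ->
  (amitsur_mx F inj_j (rect (d i) (l i)) <= IdP mul A0 A1 inv n)%MS.
Proof.
move=> dec hE; apply/row_subP => a; rewrite rowE; apply/IdPP/amitsur_mx_sid => s hs.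
set k := kk d l i in j inj_j *.
have [b bE] := word_interleave (mem (codom (Jvar j))) s (monw (monOf a)).
have uw : uniq (monw (monOf a)) by rewrite map_inj_uniq ?enum_uniq //; apply: perm_inj.
have wT x : x \in monw (monOf a).
  by apply/mapP; exists ((monOf a)^-1 x)%g; rewrite ?mem_enum ?permKV.
have [tau tauE] := codom_order (Jvar_inj inj_j) uw wT.
pose a' y := s (Jvar j (tau y)).
have ha' y : Aset A0 A1 inv i (a' y) by apply: (hs (Jvar j (tau y))).
rewrite -[RHS](satisfies_E_interleave dec b hE ha').
(* Conjugating the summation index by [tau] makes it permute positions in the word instead of
   variables; the class function [Schar] does not notice. *)
rewrite (reindex_inj (@conjg_inj _ tau)) /=; apply: eq_bigr => p _.
rewrite ScharJ; congr (_ *: _); rewrite /mon_value evalwE big_map; congr (odflt 0 _).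
rewrite bE => [|x nx]; last by rewrite /= gact_gins_out.
congr interleave; rewrite tauE -map_comp; apply: eq_map => y /=.
by rewrite gact_gins_in conjgE !permM permK.
Qed.

Lemma perm_of_word (T : finType) (w : seq T) : uniq w -> (forall x, x \in w) ->
  exists p : {perm T}, [seq p x | x <- enum T] = w.
Proof.
move=> uw wT.
have szw : size w = #|T|.
  rewrite cardE; apply: perm_size; apply: uniq_perm => //; first exact: enum_uniq.
  by move=> x; rewrite mem_enum wT.
case E : w => [|x0 w'].
  by exists 1%g; rewrite (size0nil (s := enum T)) // -cardE -szw E.
rewrite -E; pose f (x : T) := nth x0 w (enum_rank x).
have lt (x : T) : (enum_rank x < size w)%N by rewrite szw.
have inj_f : injective f.
  move=> x y /eqP; rewrite /f nth_uniq // => /eqP /val_inj.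
  exact: enum_rank_inj.
exists (perm inj_f); apply: (@eq_from_nth _ x0) => [|m]; first by rewrite size_map -cardE.
rewrite size_map -cardE => mT.
rewrite (nth_map x0) -?cardE // permE /f.
have -> : nth x0 (enum T) m = enum_val (Ordinal mT) by rewrite (enum_val_nth x0).
by rewrite enum_valK.
Qed.

(** * Realizing an Amitsur word as a multilinear monomial *)

Section WordVariables.
Variables (k : nat) (c : 'I_k.+1 -> option 'I_4) (i : 'I_4).
Hypothesis k_gt0 : (0 < k)%N.

(* The letters of the Amitsur word: inl j is the j-th special variable and
   inr j is x_j, which is absent when c j = None. *)
Let letter : finType := ('I_k + 'I_k.+1)%type.

Definition kind (x : letter) : option 'I_4 :=
  match x with inl _ => Some i | inr j => c j end.

(** The multidegree of the word, chosen so that the variables of P_<n> correspond one to one to the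
    letters present. *)
Definition kind_count (t : 'I_4) : nat := #|[pred x : letter | kind x == Some t]|.

Definition var_letter (x : Xvar kind_count) : letter := enum_val (tagged x).

Lemma kind_var_letter x : kind (var_letter x) = Some (tag x).
Proof. by apply/eqP; have := enum_valP (tagged x); rewrite inE. Qed.

Lemma var_letter_inj : injective var_letter.
Proof.
move=> x y e; have : tag x = tag y.
  by apply: Some_inj; rewrite -!kind_var_letter e.
case: x y e => [t p] [t' q] /= e ett'; case: t' / ett' in q e *.
by congr (existT _ _ _); apply: enum_val_inj e.
Qed.

Lemma special_kind (y : 'I_k) : inl y \in [pred x : letter | kind x == Some i].
Proof. by rewrite inE. Qed.

Definition special_var (y : 'I_k) : 'I_(kind_count i) :=
  enum_rank_in (special_kind (Ordinal k_gt0)) (inl y).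

Lemma var_letter_special y : var_letter (Jvar special_var y) = inl y.
Proof. by rewrite /var_letter /= enum_rankK_in // special_kind. Qed.

Lemma special_var_inj : injective special_var.
Proof.
move=> y y' e; have := var_letter_special y; rewrite /Jvar e.
by rewrite -/(Jvar special_var y') var_letter_special => -[].
Qed.

Lemma var_letter_surj (x : letter) : kind x != None -> exists v, var_letter v = x.
Proof.
case E : (kind x) => [t|] // _.
have xt : x \in [pred x : letter | kind x == Some t] by rewrite inE E.
exists (Tagged (fun t => 'I_(kind_count t)) (enum_rank_in xt x)).
by rewrite /var_letter /= enum_rankK_in.
Qed.

Definition full_word : seq letter :=
  flatten [seq [:: inr (widen_ord (leqnSn k) j); inl j] | j <- enum 'I_k] ++ [:: inr ord_max].

Lemma mem_full_word (x : letter) : x \in full_word.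
Proof.
rewrite /full_word mem_cat; case: x => [y|y].
  apply/orP; left; apply/flatten_mapP; exists y; rewrite ?mem_enum //.
  by rewrite !inE eqxx orbT.
have [lt|ge] := ltnP y k.
  apply/orP; left; apply/flatten_mapP; exists (Ordinal lt); rewrite ?mem_enum //.
  rewrite !inE; apply/orP; left; apply/eqP; congr inr; exact: val_inj.
apply/orP; right; rewrite inE; apply/eqP; congr inr; apply: val_inj => /=.
by apply/eqP; rewrite eqn_leq ge -ltnS ltn_ord.
Qed.

Lemma uniq_full_word : uniq full_word.
Proof.
apply: (@leq_size_uniq _ (enum letter)); first exact: enum_uniq.
  by move=> x _; apply: mem_full_word.
rewrite -cardE card_sum !card_ord size_cat size_flatten /seq.shape -map_comp.
rewrite (eq_map (g := fun _ => 2%N)) // sumnE big_map big_const_seq count_predT size_enum_ord.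
by rewrite iter_addn_0 /=; lia.
Qed.

Lemma exists_amitsur_monomial : exists p : {perm Xvar kind_count},
  [seq var_letter (p x) | x <- enum (Xvar kind_count)]
    = [seq x <- full_word | kind x != None].
Proof.
have x0 : Xvar kind_count := Jvar special_var (Ordinal k_gt0).
pose g (x : letter) := odflt x0 [pick v | var_letter v == x].
have gK (x : letter) : kind x != None -> var_letter (g x) = x.
  move=> /var_letter_surj [v ve]; rewrite /g; case: pickP => [u /eqP //|/(_ v)].
  by rewrite ve eqxx.
pose w := [seq x <- full_word | kind x != None].
have gw : [seq var_letter v | v <- [seq g x | x <- w]] = w.
  rewrite -map_comp -[RHS]map_id; apply/eq_in_map => x.
  by rewrite mem_filter => /andP [kx _] /=; apply: gK.
have [||p pE] := @perm_of_word _ [seq g x | x <- w].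
- by apply: (map_uniq (f := var_letter)); rewrite gw filter_uniq // uniq_full_word.
- move=> v; apply/mapP; exists (var_letter v).
    by rewrite mem_filter mem_full_word kind_var_letter.
  by apply: var_letter_inj; rewrite gK // kind_var_letter.
by exists p; rewrite -[RHS]gw -pE -map_comp.
Qed.

Lemma amitsur_word_full (a : 'I_k -> V) (b : 'I_k.+1 -> V) (s : {perm 'I_k}) :
  amitsur_word a (fun j => omap (fun _ => b j) (c j)) s =
  [seq match x with inl y => a (s y) | inr y => b y end
     | x <- [seq x <- full_word | kind x != None]].
Proof.
rewrite /full_word filter_cat map_cat filter_flatten map_flatten; congr (_ ++ _).
  by congr flatten; rewrite -[in RHS]map_comp -[in RHS]map_comp; apply: eq_map => y /=; case: (c _).
by rewrite /=; case: (c _).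
Qed.

End WordVariables.

(** The Amitsur word with the special letters in their standard order is one monomial of P_<n>. Its
    row in [amitsur_mx] is an identity, and substituting [a] and [b] for its variables gives E. *)
Lemma amitsur_of_amitsur_mx (A0 A1 : V -> Prop) (inv : V -> V) (k : nat) (i : 'I_4) mu
    (c : 'I_k.+1 -> option 'I_4) (k_gt0 : (0 < k)%N)
    (a : 'I_k -> V) (b : 'I_k.+1 -> V) :
  (amitsur_mx F (@special_var_inj k c i k_gt0) mu <= IdP mul A0 A1 inv (kind_count c i))%MS ->
  (forall j, Aset A0 A1 inv i (a j)) ->
  (forall j t, c j = Some t -> Aset A0 A1 inv t (b j)) ->
  \sum_(s : {perm 'I_k}) (Schar mu s)%:~R *:
     evalw mul (amitsur_word a (fun j => omap (fun _ => b j) (c j)) s) = 0.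
Proof.
move=> YU ha hb.
have [p pE] := exists_amitsur_monomial c i k_gt0.
pose subst (s : {perm 'I_k}) (x : 'I_k + 'I_k.+1) : V :=
  match x with inl y => a (s y) | inr y => b y end.
pose s0 (v : Xvar (kind_count c i)) := subst 1%g (var_letter v).
have hs0 v : Aset A0 A1 inv (tag v) (s0 v).
  have := kind_var_letter v; rewrite /s0; case: (var_letter v) => [y|y] /=.
    by case=> <-; apply: ha.
  exact: hb.
have /IdPP/amitsur_mx_sid /(_ s0 hs0) e :
    ((delta_mx 0 (enum_rank p) : 'rV_(Pdim (kind_count c i))) *m
      amitsur_mx F (@special_var_inj k c i k_gt0) mu <= IdP mul A0 A1 inv (kind_count c i))%MS.
  by rewrite -rowE (submx_trans (row_sub _ _)).
rewrite -[RHS]e; apply: eq_bigr => s _; congr (_ *: evalw _ _).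
rewrite (amitsur_word_full c i) -pE /monw /monOf enum_rankK -!map_comp.
apply: eq_map => x /=; rewrite -/(subst s _) /s0.
have [/codomP [y ->]|nx] := boolP (p x \in codom (Jvar (special_var c i k_gt0))).
  by rewrite gact_gins_in !var_letter_special /= perm1.
rewrite gact_gins_out //; case E : (var_letter (p x)) => [y|y] //=.
case/negP: nx; apply/codomP; exists y; apply: var_letter_inj.
by rewrite E var_letter_special.
Qed.

End Words.

Lemma homogeneous_decomposition (F : fieldType) (charF0 : [pchar F] =i pred0)
    (V : lmodType F) (mul : V -> V -> V) (A0 A1 : V -> Prop) (inv : V -> V)
    (super : bool) : superalg_with_inv mul A0 A1 inv super ->
  forall v, exists f : 'I_4 -> V,
    (forall t, Aset A0 A1 inv t (f t)) /\ v = \sum_t f t.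
Proof.
case=> _ [sub0 sub1] [dec _] _ [invL invA invK _] v.
have two0 : (2%:R : F) != 0 by rewrite char0_natr_eq0.
have [a0 [a1 [h0 h1 ->]]] := dec v.
pose e (t : 'I_4) := if (2 <= t)%N then a1 else a0.
have eA (t : 'I_4) : Agr A0 A1 (2 <= t)%N (e t) by rewrite /e; case: ifP.
have sub (b : bool) : subspaceP (Agr A0 A1 b) by case: b.
have invD x y : inv (x + y) = inv x + inv y by rewrite -[x]scale1r invL !scale1r.
have inv0 : inv 0 = 0 by apply: (addrI (inv 0)); rewrite -invD !addr0.
have invZ c x : inv (c *: x) = c *: inv x by rewrite -[c *: x]addr0 invL inv0 addr0.
(* The usual halves (v + v#)/2 and (v - v#)/2 of each homogeneous part; odd [t] are the skew
   kinds. *)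
exists (fun t : 'I_4 => 2%:R^-1 *: ((-1) ^+ (odd t) *: inv (e t) + e t)); split=> [t|].
  have [s0 sL] := sub (2 <= t)%N; split.
    rewrite -[_ *: (_ + _)]addr0.
    exact: (sL _ _ _ (sL _ _ _ (invA _ _ (eA t)) (eA t)) s0).
  rewrite invZ invD invZ invK; case: (odd t) => /=.
    by rewrite expr1 !scaleN1r -scalerN opprD opprK addrC.
  by rewrite expr0 !scale1r addrC.
have half x : 2%:R^-1 *: (inv x + x) + 2%:R^-1 *: (- inv x + x) = x.
  rewrite -scalerDr addrACA subrr add0r -mulr2n -scaler_nat scalerA mulVf //.
  by rewrite scale1r.
rewrite !big_ord_recl big_ord0 addr0 /e /= !expr0 !expr1 !scale1r !scaleN1r.
by rewrite addrA half half.
Qed.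

Lemma rect_partition d l : is_partition (l.+1 * d.+1) (rect d l).
Proof.
apply/and3P; split; last by rewrite sumn_nseq.
  rewrite /rect; apply/(sortedP 0%N) => i; rewrite size_nseq => id.
  by rewrite !nth_nseq id (ltnW id) /=.
by rewrite all_nseq.
Qed.

(** The parts decrease, so containing the rectangle only needs checking on its last row, of index
    [d]. *)
Lemma rect_subP n d l lam : is_partition n lam ->
  (forall i, nth 0 (rect d l) i <= nth 0 lam i)%N <-> ~~ in_hook d l lam.
Proof.
move=> pl; rewrite /in_hook -ltnNge; split=> [/(_ d)|h i].
  by rewrite nth_nseq ltnSn.
rewrite nth_nseq; case: ifP => // id.
by apply: leq_trans h (is_partition_dec pl _); rewrite -ltnS.
Qed.

Lemma rect_le n d l lam : is_partition n lam -> ~~ in_hook d l lam -> (l.+1 * d.+1 <= n)%N.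
Proof.
move=> pl /(rect_subP d l pl) sub.
have sl := is_partition_size pl; pose N := maxn n d.+1.
rewrite -(is_partition_sum (N := N) (rect_partition d l)); last first.
  by rewrite size_nseq leq_maxr.
rewrite -[X in (_ <= X)%N](is_partition_sum (N := N) pl); last first.
  by rewrite (leq_trans sl) // leq_maxl.
exact: leq_sum.
Qed.

Theorem theorem7p2 (F : fieldType) (charF0 : [pchar F] =i pred0)
    (V : lmodType F) (mul : V -> V -> V) (A0 A1 : V -> Prop) (inv : V -> V)
    (super : bool)
    (hA : superalg_with_inv mul A0 A1 inv super)
    (hPI : PI_algebra mul)
    (d l : 'I_4 -> nat) :
  satisfies_E mul A0 A1 inv d l <->
  (forall (n : 'I_4 -> nat) (lam : 'I_4 -> seq nat),
     (forall t, is_partition (n t) (lam t)) ->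
     ~~ [forall t, in_hook (d t) (l t) (lam t)] ->
     mult mul A0 A1 inv n lam = 0).
Proof.
have dec := homogeneous_decomposition charF0 hA.
have [[mulDl mulDr mulA] _ _ _ _] := hA.
split=> [hE n lam pl|hm i c a b ha hb].
  rewrite negb_forall => /existsP [t nh].
  have kn : (kk d l t <= n t)%N := rect_le (pl t) nh.
  (* The special variables are the first [kk d l t] of kind [t]; there are enough of them because
     the rectangle fits inside [lam t]. *)
  have inj_w : injective (widen_ord kn) by move=> x y /(congr1 val) /= /val_inj.
  apply/(mult_eq0P charF0 mul A0 A1 inv pl).
  apply: (isotypic_mx_sub_of_amitsur_mx charF0 pl (inj_j := inj_w) (rect_partition (d t) (l t))).
    by apply/(rect_subP _ _ (pl t)).
  exact: (amitsur_mx_sub_of_E mulDl mulDr mulA).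
have k_gt0 : (0 < kk d l i)%N by [].
apply: (@amitsur_of_amitsur_mx F V mul _ _ _ _ _ _ _ k_gt0 _ _ _ ha hb).
apply: (sub_IdP_of_isotypic_mx charF0) => lam pl.
have pm := rect_partition (d i) (l i).
(* Inside the hook z_lam annihilates [amitsur_mx]; outside it z_lam already maps into the identities
   by hypothesis, and these are stable under the group. *)
have [inh|nh] := boolP (in_hook (d i) (l i) (lam i)).
  rewrite isotypic_mx_mul_amitsur_mx_eq0 ?sub0mx // => /(rect_subP _ _ (pl i)).
  by rewrite inh.
have ZU : (isotypic_mx F _ lam <= IdP mul A0 A1 inv (kind_count c i))%MS.
  apply/(mult_eq0P charF0 mul A0 A1 inv pl)/hm => //.
  by rewrite negb_forall; apply/existsP; exists i.
rewrite mulmx_sumr; apply: summx_sub => s _; rewrite -scalemxAr.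
by apply: scalemx_sub; apply: sub_IdP_gmat.
Qed.
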